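(* There exists an absolute constant $c>0$ such that the following holds. Let $\epsilon>0$ be a small enough constant and let $\delta>0$ be such that $\delta\le \epsilon^4$. Let $G=(V,E)$ be an $(n,d,\lambda)$-graph with $\frac{\lambda}{d}\le \delta$. Let $p=\frac{1+\epsilon}{d}$. Form $G_p$ by retaining every edge of $G$ independently with probability $p$. Let $L_1$ be the giant (largest) connected component of $G_p$. Then, with high probability, there exists $L_1'\subseteq L_1$ with $|L_1'|\ge\frac{7\epsilon n}{4}$ such that for every $S\subseteq L_1'$ with $|S|\le \frac{|L_1'|}{2}$, $$\big|N_{L_1'}(S)\big|\ge\frac{c\, \epsilon^2|S|}{\ln^2\left(\frac{1}{\epsilon}\right)}.$$
   Context: An $(n,d,\lambda)$-graph is a $d$-regular graph on $n$ vertices whose adjacency matrix has eigenvalues $d=\lambda_1\ge\lambda_2\ge\dots\ge\lambda_n$ with $\lambda=\max\{|\lambda_2|,|\lambda_n|\}$. For $S\subseteq L_1'$, $N_{L_1'}(S)$ is the external neighbourhood of $S$ in the induced subgraph $G_p[L_1']$, i.e. the set of vertices of $L_1'\setminus S$ having at least one $G_p$-neighbour in $S$. ''With high probability'' means with probability tending to $1$ as $n\to\infty$, where $\epsilon,\delta$ are fixed and $G=G_n$ ranges over any sequence of $(n,d,\lambda)$-graphs satisfying the hypotheses ($d,\lambda$ may depend on $n$). ''$\epsilon$ small enough constant'' means that there is an absolute constant $\epsilon_0>0$ such that the statement holds for every fixed $0<\epsilon\le\epsilon_0$; ''absolute constant'' means independent of $\epsilon,\delta,n,d,\lambda,G$.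 The component $L_1$ is identified with its vertex set. $\ln$ is the natural logarithm. *)

(* Defs.v *)
From HB Require Import structures.
From mathcomp Require Import all_boot all_order all_algebra.
From mathcomp Require Import all_classical all_reals all_analysis.

Set Implicit Arguments.
Unset Strict Implicit.
Unset Printing Implicit Defensive.

Import Order.TTheory GRing.Theory Num.Theory.
Import numFieldNormedType.Exports.

Local Open Scope ring_scope.

Definition simple_graph (n : nat) (G : rel 'I_n) : Prop :=
  symmetric G /\ irreflexive G.

Definition regular_graph (n d : nat) (G : rel 'I_n) : Prop :=
  forall v : 'I_n, #|[set w | G v w]| = d.

Definition adjacency_mx (R : realType) (n : nat) (G : rel 'I_n) : 'M[R]_n :=
  \matrix_(i, j) (G i j)%:R.

(* [s] lists all eigenvalues of [A] with multiplicity, in nonincreasing order;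
   [s] is unique if it exists, and the i-th largest eigenvalue is [s`_(i.-1)]. *)
Definition eigenvalues (R : realType) (n : nat) (A : 'M[R]_n) (s : seq R) :
    Prop :=
  sorted >=%R s /\ char_poly A = \prod_(x <- s) ('X - x%:P).

Definition ndl_graph (R : realType) (n d : nat) (lambda : R) (G : rel 'I_n) :
    Prop :=
  [/\ simple_graph G, regular_graph d G
    & exists s : seq R,
        [/\ eigenvalues (adjacency_mx R G) s, s`_0 = d%:R
          & lambda = Num.max `|s`_1| `|s`_n.-1| ] ].

Definition edges (n : nat) (G : rel 'I_n) : {set {set 'I_n}} :=
  [set [set u.1; u.2] | u : 'I_n * 'I_n & G u.1 u.2].

Definition edge_rel (n : nat) (F : {set {set 'I_n}}) : rel 'I_n :=
  [rel u v | [set u; v] \in F].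

(* Probability that the random subgraph of [G] satisfies [Q] when each edge is
   retained independently with probability [p]; the outcome is the set [F] of
   retained edges, [edge_rel F] being the resulting graph.  This is a
   probability only for [0 <= p <= 1]. *)
Definition percolation_pr (R : realType) (n : nat) (G : rel 'I_n) (p : R)
    (Q : rel 'I_n -> Prop) : R :=
  \sum_(F in powerset (edges G) | `[< Q (edge_rel F) >])
    \prod_(f in edges G) (if f \in F then p else 1 - p).

Definition component (n : nat) (G : rel 'I_n) (v : 'I_n) : {set 'I_n} :=
  [set w | connect G v w].

Definition largest_component (n : nat) (G : rel 'I_n) (L : {set 'I_n}) : Prop :=
  (exists v, L = component G v) /\ (forall w, (#|component G w| <= #|L|)%N).

(* External neighbourhood of [S] in the subgraph of [G] induced on [A]. *)
Definition ext_nbhd (n : nat) (G : rel 'I_n) (A S : {set 'I_n}) : {set 'I_n} :=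
  [set v in A :\: S | [exists u in S, G u v]].

(* Main.v *)
Require Import Defs.
From HB Require Import structures.
From mathcomp Require Import all_boot all_order all_algebra.
From mathcomp Require Import all_classical all_reals all_analysis.
From mathcomp Require Import ring lra complex.

Set Implicit Arguments.
Unset Strict Implicit.
Unset Printing Implicit Defensive.

Import Order.TTheory GRing.Theory Num.Theory.
Import numFieldNormedType.Exports.
Import mathcomp.boot.fintype mathcomp.boot.finset.

Local Open Scope ring_scope.

(** The random graph is generated in two independent rounds, the first with
    edge probability slightly below (1 + eps) / d and the second with edge
    probability of order eps / d. Let W be the set of vertices that the first
    round puts in components of at least K vertices, K being a large constant
    depending on eps only. The set L1' is W without a small part that does not
    expand.

    Size of W. The component of a vertex is explored one edge at a time. An
    exponential martingale of the number of edges left to query bounds the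
    probability that the exploration stops early, from above if small sets have
    almost all of their edges in their boundary ([prob_reach_lt_le]), and from
    below if the degrees are at most d ([prob_reach_lt_ge]). The first
    hypothesis follows from the eigenvalues ([boundary_ge]). So a vertex lies in
    a large component with probability about 2 eps, and as one edge changes the
    number of such vertices by at most 2 K, this number is concentrated
    ([variance_le]).

    Expansion of linear sets. Let S and its complement in W both have at least
    eps n / 100 vertices. If few edges join them, then in particular few edges
    of the first round do. Since the first round restricted to W has few
    components, there are few such sets S ([card_small_cuts]). On the other hand
    many edges of G join the two sets ([mixing]), and each of them is present in
    the second round with probability of order eps / d; hence it is
    exponentially unlikely that the second round contains few of them. A union
    bound excludes all sparse cuts ([sparse_cut_prob]). A large edge cut gives
    many neighbours because few edges meet vertices whose degree exceeds a
    multiple of ln (1 / eps) ([expect_heavy], [cut_le_nbhd]). One factor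
    ln (1 / eps) is lost here and one in the count of sparse cuts.

    Small sets. Removing from W a largest set that does not expand yields a set
    in which all sets of at most half the size expand ([prune]). Such a set is
    connected. It lies in the largest component, as otherwise two components
    would have at least 7/4 eps n vertices each, whereas fewer than 16/5 eps n
    vertices are in components of at least K vertices ([giant_contains]). *)

(** * Product measures on subsets of a finite set *)

Section Percolation.

Variables (R : realType) (T : finType).
Implicit Types (p : R) (U F B : {set T}) (f g : {set T} -> R).

(** The percolation measure of [percolation_pr], on an arbitrary finite ground
    set so that elements of the ground set can be removed one at a time. *)
Definition pweight p U F : R := \prod_(e in U) (if e \in F then p else 1 - p).

Definition expect p U f : R := \sum_(F in powerset U) pweight p U F * f F.

Lemma expect_set0 p f : expect p set0 f = f set0.
Proof. by rewrite /expect powerset0 big_set1 /pweight big_set0 mul1r. Qed.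

Lemma eq_expect p U f g :
  (forall F, F \subset U -> f F = g F) -> expect p U f = expect p U g.
Proof. by move=> fg; apply: eq_bigr => F; rewrite inE => /fg ->. Qed.

(** Conditioning on one element; inductions that peel elements off the ground
    set rest on this identity. *)
Lemma expect_split p U e f : e \in U ->
  expect p U f = (1 - p) * expect p (U :\ e) f
                 + p * expect p (U :\ e) (fun F => f (e |: F)).
Proof.
move=> eU; rewrite /expect !mulr_sumr (bigID (fun F => e \in F)) /= addrC.
congr (_ + _).
  apply: eq_big => [F|F]; first by rewrite !inE subsetD1.
  rewrite inE => /andP[_ eF]; rewrite /pweight (big_setD1 e) //= (negbTE eF).
  by rewrite mulrA.
rewrite (reindex_onto (fun F => e |: F) (fun F => F :\ e)) /=; last first.
  by move=> F /andP[_ eF]; rewrite setD1K.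
apply: eq_big => [F|F].
  rewrite !inE subUset sub1set eU /= eqxx /= andbT subsetD1.
  apply: andb_id2l => FU; apply/eqP/idP => [<-|eF]; first by rewrite !inE eqxx.
  by rewrite setU1K.
rewrite !inE => /andP[/andP[FU _]] /eqP FE.
rewrite /pweight (big_setD1 e) //= !inE eqxx /= mulrA; congr (_ * _ * _).
by apply: eq_bigr => e'; rewrite !inE => /andP[/negbTE ->].
Qed.

Lemma expectD p U f g :
  expect p U (fun F => f F + g F) = expect p U f + expect p U g.
Proof. by rewrite /expect -big_split; apply: eq_bigr => F _; rewrite mulrDr. Qed.

Lemma expectZ p U a f : expect p U (fun F => a * f F) = a * expect p U f.
Proof. by rewrite /expect mulr_sumr; apply: eq_bigr => F _; rewrite mulrCA. Qed.

Lemma expect_sum p U (I : finType) (P : pred I) (f : I -> {set T} -> R) :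
  expect p U (fun F => \sum_(i | P i) f i F) = \sum_(i | P i) expect p U (f i).
Proof.
rewrite /expect exchange_big /=; apply: eq_bigr => F _.
by rewrite mulr_sumr.
Qed.

Lemma set_remove_ind (P : {set T} -> Prop) :
  P set0 -> (forall U e, e \in U -> P (U :\ e) -> P U) -> forall U, P U.
Proof.
move=> P0 PS U; have [k] := ubnP #|U|; elim: k U => // k IHk U ltUk.
have [->//|[e eU]] := set_0Vmem U.
by apply: (PS U e eU); apply: IHk; move: ltUk; rewrite (cardsD1 e) eU.
Qed.

Lemma expect_cst p U a : expect p U (fun=> a) = a.
Proof.
elim/set_remove_ind: U => [|U e eU IH]; first by rewrite expect_set0.
by rewrite (expect_split _ _ eU) IH; ring.
Qed.

Lemma le_expect p U f g : 0 <= p <= 1 ->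
  (forall F, F \subset U -> f F <= g F) -> expect p U f <= expect p U g.
Proof.
move=> /andP[p0 p1] fg; apply: ler_sum => F; rewrite inE => FU.
rewrite ler_wpM2l ?fg //; apply: prodr_ge0 => e _; case: ifP => // _.
by rewrite subr_ge0.
Qed.

Lemma expect_exp_card p U B (c : R) :
  expect p U (fun F => c ^+ #|F :&: B|) = (1 - p + p * c) ^+ #|U :&: B|.
Proof.
elim/set_remove_ind: U => [|U e eU IH].
  by rewrite expect_set0 set0I cards0 !expr0.
rewrite (expect_split _ _ eU) IH.
have UeB : (U :\ e) :&: B = (U :&: B) :\ e by rewrite setIDAC.
have [eB|eB] := boolP (e \in B); last first.
  have sB F : (e |: F) :&: B = F :&: B.
    apply/setP => x; rewrite !inE; case: eqVneq => // ->.
    by rewrite (negbTE eB) !andbF.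
  have -> : (U :\ e) :&: B = U :&: B.
    apply/setP => x; rewrite !inE; case: eqVneq => // ->.
    by rewrite (negbTE eB) !andbF.
  under eq_expect do rewrite sB.
  have -> : U :&: B = (U :\ e) :&: B.
    apply/setP => x; rewrite !inE; case: eqVneq => // ->.
    by rewrite (negbTE eB) !andbF.
  by rewrite IH; ring.
rewrite (@eq_expect _ _ _ (fun F => c * c ^+ #|F :&: B|)) => [|F FU].
  rewrite expectZ IH [in RHS](cardsD1 e) inE eU eB add1n exprS UeB; ring.
rewrite -exprS setIUl; have /setIidPl -> : [set e] \subset B by rewrite sub1set.
rewrite cardsU1 inE; move: FU; rewrite subsetD1 => /andP[_ /negbTE->].
by rewrite add1n.
Qed.

(** Sprinkling: an element is absent from the union of two independent rounds
    exactly when both rounds miss it. *)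
Lemma expect_union p p1 p2 U f : 1 - p = (1 - p1) * (1 - p2) ->
  expect p U f
  = expect p1 U (fun F1 => expect p2 U (fun F2 => f (F1 :|: F2))).
Proof.
move=> pE; have {pE} -> : p = p1 + p2 - p1 * p2 by nra.
elim/set_remove_ind: U f => [|U e eU IH] f; first by rewrite !expect_set0 setU0.
rewrite (expect_split _ _ eU) !IH (expect_split p1 _ eU).
under [in RHS]eq_expect do rewrite (expect_split p2 _ eU).
under [X in _ = _ + p1 * X]eq_expect do rewrite (expect_split p2 _ eU).
rewrite !expectD !expectZ.
have E1 F1 F2 : (e |: F1) :|: (e |: F2) = e |: (F1 :|: F2).
  by rewrite setUACA setUid.
under [X in _ = _ + p1 * (_ + _ * X)]eq_expect do under eq_expect do rewrite E1.
under [X in _ = _ + p1 * (_ * X + _)]eq_expect do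
  under eq_expect do rewrite -setUA.
under [X in _ = _ * (_ + _ * X) + _]eq_expect do
  under eq_expect do rewrite setUCA.
ring.
Qed.

Definition variance p U f := expect p U (fun F => f F ^+ 2) - expect p U f ^+ 2.

(** Efron-Stein inequality. Revealing one element adds p(1 - p) times the square
    of the difference of two conditional means, and coupling the remaining
    elements shows that this difference is at most L. *)
Lemma variance_le p U f (L : R) : 0 <= p <= 1 ->
  (forall F e, F \subset U -> e \in U -> `|f (e |: F) - f F| <= L) ->
  variance p U f <= p * #|U|%:R * L ^+ 2.
Proof.
move=> p01; have /andP[p0 p1] := p01.
elim/set_remove_ind: U f => [|U e eU IH] f fL.
  by rewrite /variance !expect_set0 cards0; lra.
have sU F : F \subset U :\ e -> F \subset U by rewrite subsetD1 => /andP[].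
have V0 : variance p (U :\ e) f <= p * #|U :\ e|%:R * L ^+ 2.
  apply: IH => F e' /sU FU; rewrite !inE => /andP[_ e'U]; exact: fL.
have V1 : variance p (U :\ e) (fun F => f (e |: F)) <= p * #|U :\ e|%:R * L ^+ 2.
  apply: IH => F e' /sU FU; rewrite !inE => /andP[_ e'U].
  by rewrite setUCA; apply: fL => //; rewrite subUset sub1set eU.
have D : `|expect p (U :\ e) (fun F => f (e |: F)) - expect p (U :\ e) f| <= L.
  have dE : expect p (U :\ e) (fun F => f (e |: F)) - expect p (U :\ e) f
     = expect p (U :\ e) (fun F => f (e |: F) - f F).
    by rewrite -mulN1r -expectZ -expectD; apply: eq_expect => F _; ring.
  rewrite dE ler_norml; apply/andP; split.
    rewrite -(expect_cst p (U :\ e) (- L)); apply: le_expect => // F /sU FU.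
    by have := fL F e FU eU; rewrite ler_norml => /andP[].
  rewrite -[leRHS](expect_cst p (U :\ e)); apply: le_expect => // F /sU FU.
  by have := fL F e FU eU; rewrite ler_norml => /andP[].
move: V0 V1; rewrite /variance !(expect_split _ _ eU).
rewrite (cardsD1 e U) eU add1n -natr1.
move: (expect p (U :\ e) f) (expect p (U :\ e) (fun F => f (e |: F))) D.
move: (expect p _ (fun F => f F ^+ 2)) (expect p _ (fun F => f (e |: F) ^+ 2)).
move=> s0 s1 m0 m1 D V0 V1.
have {}D : (m1 - m0) ^+ 2 <= L ^+ 2.
  have L0 : 0 <= L by apply: le_trans D; rewrite normr_ge0.
  by rewrite -real_normK ?num_real // ler_pXn2r ?nnegrE.
have H : (1 - p) * (s0 - m0 ^+ 2) + p * (s1 - m1 ^+ 2)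
   + p * ((1 - p) * (m1 - m0) ^+ 2) <=
   (1 - p) * (p * #|U :\ e|%:R * L ^+ 2) + p * (p * #|U :\ e|%:R * L ^+ 2)
   + p * L ^+ 2.
  have q0 : 0 <= 1 - p by lra.
  rewrite lerD ?lerD ?ler_wpM2l //; apply: le_trans D.
  by rewrite ler_piMl ?sqr_ge0 //; lra.
by move: H; lra.
Qed.

Definition prob p U (Q : {set T} -> bool) := expect p U (fun F => (Q F)%:R).

Lemma chebyshev_expect p U f (L t : R) : 0 <= p <= 1 -> 0 < t ->
  (forall F e, F \subset U -> e \in U -> `|f (e |: F) - f F| <= L) ->
  prob p U (fun F => t <= `|f F - expect p U f|) <= p * #|U|%:R * L ^+ 2 / t ^+ 2.
Proof.
move=> p01 t0 /(variance_le p01) V.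
rewrite ler_pdivlMr ?exprn_gt0 //; apply: le_trans V.
set m := expect p U f.
have -> : variance p U f = expect p U (fun F => (f F - m) ^+ 2).
  under [RHS]eq_expect do rewrite sqrrB -addrA.
  rewrite expectD expectD expect_cst.
  rewrite (@eq_expect _ _ (fun F => - (f F * m *+ 2)) (fun F => - (2 * m) * f F)).
    by rewrite expectZ /variance -/m; ring.
  by move=> F _; ring.
rewrite mulrC -expectZ; apply: le_expect => // F _ /=.
case: (leP t) => [h|_]; last by rewrite mulr0 sqr_ge0.
rewrite mulr1 -(@real_normK _ (f F - m)) ?num_real //.
by rewrite ler_pXn2r ?nnegrE // ltW.
Qed.

End Percolation.

(** * Exploring components edge by edge *)

Section Exploration.

Variable n : nat.
Implicit Types (A B S T : {set 'I_n}) (F U E : {set {set 'I_n}}).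

Lemma edge_relC F u v : edge_rel F u v = edge_rel F v u.
Proof. by rewrite /edge_rel /= setUC. Qed.

(** Starting from a set instead of a vertex lets the exploration of a component
    be an induction in which the explored set grows. *)
Definition reach F A := [set w | [exists a in A, connect (edge_rel F) a w]].

Definition edge_closed F B := forall u v, edge_rel F u v -> u \in B -> v \in B.

Lemma sub_reach F A : A \subset reach F A.
Proof.
by apply/subsetP => a aA; rewrite inE; apply/exists_inP; exists a.
Qed.

Lemma reach_closed F A : edge_closed F (reach F A).
Proof.
move=> u v uv; rewrite !inE => /exists_inP[a aA au].
by apply/exists_inP; exists a => //; apply: connect_trans au (connect1 uv).
Qed.

Lemma reach_min F A B : A \subset B -> edge_closed F B -> reach F A \subset B.
Proof.
move=> /subsetP AB FB; apply/subsetP => w; rewrite inE => /exists_inP[a /AB].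
move=> aB /connectP[s pth ->]; elim: s a aB pth => //= b s IH a aB /andP[ab].
by apply: IH; apply: FB aB.
Qed.

Lemma reach_component F v : reach F [set v] = component (edge_rel F) v.
Proof.
apply/setP => w; rewrite !inE; apply/exists_inP/idP => [[a]|vw].
  by rewrite inE => /eqP ->.
by exists v; rewrite ?inE.
Qed.

Definition cut F S T : {set {set 'I_n}} :=
  [set f in F | [exists u in S, exists v in T, f == [set u; v]]].

Lemma cutP F S T f :
  reflect (exists u v, [/\ u \in S, v \in T, f = [set u; v] & f \in F])
          (f \in cut F S T).
Proof.
rewrite inE; apply: (iffP andP) => [[fF /exists_inP[u uS /exists_inP[v vT /eqP fE]]]|].
  by exists u, v.
move=> [u [v [uS vT fE fF]]]; split=> //.
by apply/exists_inP; exists u => //; apply/exists_inP; exists v => //; apply/eqP.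
Qed.

Lemma reach_cut0 F A : cut F A (~: A) = set0 -> reach F A = A.
Proof.
move=> c0; apply/eqP; rewrite eqEsubset sub_reach andbT.
apply: reach_min => // u v uv uA; apply: contraT => vA.
have : [set u; v] \in cut F A (~: A).
  by apply/cutP; exists u, v; split => //; rewrite inE.
by rewrite c0 inE.
Qed.

(** The step of the exploration that finds a new vertex: an edge inside the
    explored set no longer matters for what can be reached. *)
Lemma reach_addedge F A a b : a \in A ->
  reach ([set a; b] |: F) A = reach F (b |: A).
Proof.
move=> aA; apply/eqP; rewrite eqEsubset; apply/andP; split.
  apply: reach_min; first exact: subset_trans (subsetU1 b A) (sub_reach _ _).
  have /subsetP bA := sub_reach F (b |: A).
  move=> u v; rewrite /edge_rel /= in_setU1 => /orP[/eqP uv _|uv]; last first.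
    exact: reach_closed.
  have : v \in [set a; b] by rewrite -uv !inE eqxx orbT.
  by rewrite in_set2 => /orP[]/eqP->; apply: bA; rewrite !inE ?aA ?eqxx ?orbT.
apply: reach_min => [|u v uv]; last first.
  by apply: reach_closed; rewrite /edge_rel /= inE; apply/orP; right.
rewrite subUset sub_reach andbT sub1set.
apply: (@reach_closed _ A a); first by rewrite /edge_rel /= !inE eqxx.
exact: (subsetP (sub_reach _ _)).
Qed.

Variable R : realType.
Implicit Types (p z : R).

Lemma explore_step p U A a b (h : {set 'I_n} -> R) :
  a \in A -> [set a; b] \in U ->
  expect p U (fun F => h (reach F A)) =
  (1 - p) * expect p (U :\ [set a; b]) (fun F => h (reach F A)) +
  p * expect p (U :\ [set a; b]) (fun F => h (reach F (b |: A))).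
Proof.
move=> aA eU; rewrite (expect_split _ _ eU).
by congr (_ + _ * _); apply: eq_expect => F _; rewrite reach_addedge.
Qed.

Lemma cards_setD_remove E U (e : {set 'I_n}) : U \subset E -> e \in U ->
  #|E :\: (U :\ e)| = #|E :\: U|.+1.
Proof.
move=> UE eU; rewrite (_ : E :\: _ = e |: (E :\: U)).
  by rewrite cardsU1 !inE eU.
apply/setP => x; rewrite !inE; case: eqVneq => [->|] //=.
exact: (subsetP UE).
Qed.

(** The exploration queries the edges that leave the explored set one at a time.
    With m explored vertices and t queried edges, z^(D m - t) is a
    supermartingale: a query contributes a factor 1/z, and with probability p a
    new vertex contributes z^D. If the exploration stops with m < K vertices,
    all of their at least D m boundary edges have been queried, so that the
    potential has become at least 1. In the proof U is the set of edges that
    have not been queried. *)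
Lemma prob_reach_lt_le p z E (K D : nat) A : 0 <= p <= 1 -> 0 < z <= 1 ->
  1 - p + p * z ^+ D <= z ->
  (forall A, A != set0 -> (#|A| < K)%N -> (D * #|A| <= #|cut E A (~: A)|)%N) ->
  A != set0 ->
  prob p E (fun F => (#|reach F A| < K)%N) <= z ^+ (D * #|A|).
Proof.
move=> p01 /andP[z0 z1] pz expE A0; have /andP[p0 p1] := p01.
suff claim k U : (#|U| < k)%N -> U \subset E -> forall A, A != set0 ->
    prob p U (fun F => (#|reach F A| < K)%N) * z ^+ #|E :\: U| <= z ^+ (D * #|A|).
  have := claim _ E (ltnSn _) (subxx _) A A0.
  by rewrite setDv cards0 expr0 mulr1.
elim: k U => // k IH U; rewrite ltnS => Uk UE {A0} A A0.
have z0' := ltW z0.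
have [c0|[f /cutP[a [b [aA bA -> fU]]]]] := set_0Vmem (cut U A (~: A)).
  have [AK|KA] := ltnP #|A| K.
    apply: (@le_trans _ _ (1 * z ^+ #|E :\: U|)).
      rewrite ler_wpM2r ?exprn_ge0 // -[leRHS](expect_cst p U).
      by apply: le_expect => // F _; case: (_ < K)%N; rewrite ?ler01.
    rewrite mul1r ler_wiXn2l //.
    apply: leq_trans (expE _ A0 AK) _; apply: subset_leq_card.
    apply/subsetP => f /cutP[u [v [uA vA fE fE']]].
    rewrite inE fE' andbT; apply/negP => fU.
    have : f \in cut U A (~: A) by apply/cutP; exists u, v.
    by rewrite c0 inE.
  rewrite /prob (@eq_expect _ _ _ _ _ (fun=> 0)) ?expect_cst ?mul0r ?exprn_ge0 //.
  move=> F FU; rewrite ltnNge (leq_trans KA) //.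
  exact: (subset_leq_card (sub_reach _ _)).
have ltk : (#|U :\ [set a; b]| < k)%N.
  by move: Uk; rewrite (cardsD1 [set a; b] U) fU.
have sUE : U :\ [set a; b] \subset E.
  exact: subset_trans (subsetDl _ _) UE.
have bA0 : b |: A != set0 by apply/set0Pn; exists b; rewrite !inE eqxx.
have {IH} := (IH _ ltk sUE _ A0, IH _ ltk sUE _ bA0).
rewrite /prob (@explore_step p U A a b (fun X => (#|X| < K)%N%:R)) //.
rewrite cardsU1; move: bA; rewrite inE => -> /=.
rewrite cards_setD_remove // mulnDr muln1 exprD exprS.
move: (expect _ _ _) (expect _ _ _) => y x.
move: (z ^+ #|E :\: U|) (z ^+ (D * #|A|)) (exprn_ge0 (D * #|A|) (ltW z0)) => t X X0.
move: pz; move: (z ^+ D) => w pz [h1 h2].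
rewrite -(ler_pM2l z0).
apply: (@le_trans _ _ ((1 - p) * X + p * (w * X))); last first.
  by rewrite mulrA -mulrDl ler_wpM2r.
have -> : z * (((1 - p) * x + p * y) * t)
    = (1 - p) * (x * (z * t)) + p * (y * (z * t)) by ring.
by rewrite lerD ?ler_wpM2l // subr_ge0.
Qed.

(** The potential of [prob_reach_lt_le], multiplied by th at each query, is a
    submartingale when degrees are at most D. As at most D m edges meet m
    vertices, it is at most 1 when the exploration stops early, and at most
    th^(D K) once K vertices have been reached. *)
Lemma prob_reach_lt_ge p z th E (K D : nat) A : 0 <= p <= 1 -> 0 < z <= 1 ->
  0 <= th -> th <= 1 -> z <= th * (1 - p + p * z ^+ D) ->
  (forall v, (#|[set f in E | v \in f]| <= D)%N) ->
  z ^+ (D * #|A|) <= prob p E (fun F => (#|reach F A| < K)%N) + th ^+ (D * K).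
Proof.
move=> p01 /andP[z0 z1] th0 th1 pz degE; have /andP[p0 p1] := p01.
have zth : z <= th.
  apply: le_trans pz _; rewrite ler_piMr //.
  have : z ^+ D <= 1 by rewrite exprn_ile1 // ltW.
  by nra.
pose touch A := [set f in E | [exists a in A, a \in f]].
have touchD B : (#|touch B| <= D * #|B|)%N.
  rewrite mulnC -sum_nat_const.
  apply: (@leq_trans (\sum_(v in B) #|[set f in E | v \in f]|)); last first.
    exact: leq_sum.
  rewrite (_ : touch B = \bigcup_(v in B) [set f in E | v \in f]).
    elim/big_rec2: _ => [|v m X _ IH]; first by rewrite cards0.
    by rewrite (leq_trans (leq_card_setU _ _)) // leq_add2l.
  apply/setP => f; rewrite inE; apply/andP/bigcupP.
    by move=> [fE /exists_inP[a aB af]]; exists a => //; rewrite inE fE.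
  by move=> [a aB]; rewrite inE => /andP[-> af]; split=> //; apply/exists_inP; exists a.
have prob0 U (Q : {set {set 'I_n}} -> bool) : 0 <= prob p U Q.
  by rewrite -(expect_cst p U 0); apply: le_expect => // F _.
suff claim k U : (#|U| < k)%N -> U \subset E -> forall A, E :\: U \subset touch A ->
    z ^+ (D * #|A| - #|E :\: U|) * th ^+ #|E :\: U|
    <= prob p U (fun F => (#|reach F A| < K)%N) + th ^+ (D * K).
  have := claim _ E (ltnSn _) (subxx _) A.
  by rewrite setDv cards0 expr0 mulr1 subn0; apply; rewrite sub0set.
elim: k U => // k IH U; rewrite ltnS => Uk UE {}A UA.
have tD : (#|E :\: U| <= D * #|A|)%N by apply: leq_trans (subset_leq_card UA) _.
have z0' := ltW z0.
have [KA|AK] := leqP K #|A|.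
  apply: (@le_trans _ _ (th ^+ (D * K))); last by rewrite lerDr.
  apply: (@le_trans _ _ (th ^+ (D * #|A| - #|E :\: U|) * th ^+ #|E :\: U|)).
    by rewrite ler_wpM2r ?exprn_ge0 // lerXn2r ?nnegrE.
  by rewrite -exprD subnK // ler_wiXn2l // leq_mul2l KA orbT.
have [c0|[f /cutP[a [b [aA bA -> fU]]]]] := set_0Vmem (cut U A (~: A)).
  rewrite /prob (@eq_expect _ _ _ _ _ (fun=> 1)) => [|F FU]; last first.
    rewrite reach_cut0 ?AK //; apply/eqP; rewrite -subset0 -c0.
    apply/subsetP => f /cutP[u [v [uA vA fE fF]]].
    by apply/cutP; exists u, v; split=> //; apply: (subsetP FU).
  rewrite expect_cst; apply: (@le_trans _ _ 1); last by rewrite lerDl exprn_ge0.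
  by rewrite mulr_ile1 ?exprn_ge0 ?exprn_ile1.
have ltk : (#|U :\ [set a; b]| < k)%N.
  by move: Uk; rewrite (cardsD1 [set a; b] U) fU.
have sUE : U :\ [set a; b] \subset E.
  exact: subset_trans (subsetDl _ _) UE.
have tA : E :\: (U :\ [set a; b]) \subset touch A.
  apply/subsetP => g; rewrite !inE negb_and negbK => /andP[/orP[/eqP->|gnU] gE].
    rewrite (subsetP UE) //; apply/exists_inP; exists a; rewrite // !inE eqxx //.
  have : g \in E :\: U by rewrite !inE gnU.
  by move/(subsetP UA); rewrite inE.
have tbA : E :\: (U :\ [set a; b]) \subset touch (b |: A).
  apply: subset_trans tA _; apply/subsetP => g; rewrite !inE.
  move=> /andP[-> /exists_inP[u uA uf]]; apply/exists_inP; exists u => //.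
  by rewrite inE uA orbT.
have := subset_leq_card tA; rewrite cards_setD_remove // => tlt.
have {}tlt := leq_trans tlt (touchD A).
have {IH} := (IH _ ltk sUE _ tA, IH _ ltk sUE _ tbA).
rewrite /prob (@explore_step p U A a b (fun X => (#|X| < K)%N%:R)) //.
rewrite cardsU1; move: bA; rewrite inE => -> /=.
rewrite cards_setD_remove // mulnDr muln1 -addnBA // exprD.
rewrite -(subnSK tlt) [z ^+ (_ - _).+1]exprS [th ^+ _.+1]exprS.
move: (expect _ _ _) (expect _ _ _) => y x.
move: (th ^+ #|E :\: U|) (z ^+ (D * #|A| - #|E :\: U|.+1)) (exprn_ge0 #|E :\: U| th0)
  (exprn_ge0 (D * #|A| - #|E :\: U|.+1) (ltW z0)) => t X t0 X0.
move: pz; move: (z ^+ D) (th ^+ _) => w q pz [h1 h2].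
have -> : (1 - p) * x + p * y + q = (1 - p) * (x + q) + p * (y + q) by ring.
apply: (@le_trans _ _ ((1 - p) * (X * (th * t)) + p * (w * X * (th * t)))).
  have -> : (1 - p) * (X * (th * t)) + p * (w * X * (th * t))
    = (th * (1 - p + p * w)) * (X * t) by ring.
  by rewrite -mulrA ler_wpM2r ?mulr_ge0.
by rewrite lerD ?ler_wpM2l // subr_ge0.
Qed.

End Exploration.

(** * The quadratic form of a symmetric matrix *)

Section Spectral.
Local Open Scope sesquilinear_scope.
Variable R : realType.
Local Notation toC := (real_complex R).

Lemma char_poly_conj (F : fieldType) n (P A : 'M[F]_n) : P \in unitmx ->
  char_poly (invmx P *m A *m P) = char_poly A.
Proof.
move=> Pu; have PV : map_mx polyC (invmx P) *m map_mx (@polyC F) P = 1%:M.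
  by rewrite -map_mxM mulVmx // map_mx1.
rewrite /char_poly /char_poly_mx.
have -> : 'X%:M - map_mx polyC (invmx P *m A *m P)
  = map_mx polyC (invmx P) *m ('X%:M - map_mx polyC A) *m map_mx polyC P.
  rewrite mulmxBr mulmxBl !map_mxM; congr (_ - _).
  by rewrite scalar_mxC -mulmxA PV mulmx1.
by rewrite !det_mulmx mulrAC -det_mulmx PV det1 mul1r.
Qed.

(** A real symmetric matrix is diagonalized over the complex numbers, where it
    is hermitian; the characteristic polynomial then says that its diagonal
    form carries the given eigenvalues with the same multiplicities. *)
Lemma perm_spectral n (A : 'M[R]_n) (s : seq R) : A^T = A ->
  char_poly A = \prod_(x <- s) ('X - x%:P) ->
  perm_eq [seq spectral_diag (map_mx toC A) 0 i | i <- enum 'I_n] (map toC s)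
  /\ map_mx toC A = invmx (spectralmx (map_mx toC A))
        *m diag_mx (spectral_diag (map_mx toC A)) *m spectralmx (map_mx toC A).
Proof.
move=> As Acp; set Ac := map_mx toC A.
have Ah : Ac \is hermsymmx.
  apply: realsym_hermsym.
    apply/is_hermitianmxP; rewrite expr0 scale1r map_mx_id //.
    by apply/matrixP => i j; rewrite !mxE -{1}As mxE.
  apply/mxOverP => i j; rewrite mxE realE -[0]/(toC 0) !lecR -realE.
  exact: num_real.
have /orthomx_spectralP AE : Ac \is normalmx by apply: hermitian_normalmx.
split=> //; apply: prod_XsubC_eq.
have := congr1 char_poly AE; rewrite char_poly_conj ?spectral_unit //.
rewrite [in RHS]char_poly_trig ?diag_mx_is_trig //.
rewrite -(map_char_poly toC) Acp map_prod_XsubC => E.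
have -> : enum 'I_n = index_enum (ordinal n) by rewrite enumT [index_enum _]unlock.
rewrite !big_map E.
by apply: eq_bigr => i _; rewrite mxE eqxx mulr1n.
Qed.

Lemma complex_norm_le (z w : R) : `|toC z| <= toC w -> `|z| <= w.
Proof. by rewrite normc_def /= expr0n addr0 sqrtr_sqr lecR. Qed.

(** In a unitary eigenbasis every eigenvalue but one, of index i0, is at most
    lambda in absolute value. The constant vector is an eigenvector for d >
    lambda, hence supported on the coordinate i0; so the coordinate i0 of x is
    determined by the sum of the entries of x and contributes exactly the
    subtracted main term. *)
Lemma quadratic_form_bound n (A : 'M[R]_n) (s : seq R) (d lambda : R)
    (x : 'cV[R]_n) :
  (0 < n)%N -> A^T = A -> A *m const_mx 1 = d *: const_mx 1 :> 'cV_n ->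
  char_poly A = \prod_(y <- d :: s) ('X - y%:P) ->
  (forall y, y \in s -> `|y| <= lambda) -> lambda < d ->
  `|(x^T *m A *m x) 0 0 - d * (\sum_i x i 0) ^+ 2 / n%:R|
  <= lambda * (\sum_i x i 0 ^+ 2 - (\sum_i x i 0) ^+ 2 / n%:R).
Proof.
move=> n0 As Ad Acp sl ld.
have [Ds AE] := perm_spectral As Acp.
set Ac := map_mx toC A in Ds AE *.
set P := spectralmx Ac in AE *; set D := spectral_diag Ac in Ds AE *.
have Pu : P \is unitarymx by apply: spectral_unitarymx.
have Pv : P^t* *m P = 1%:M by rewrite -invmx_unitary // mulVmx // unitarymx_unit.
(* Only the first eigenvalue may exceed lambda, so at most one index does. *)
have [i0 Di0] : exists i0, forall i, i != i0 -> `|D 0 i| <= toC lambda.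
  pose Q (z : complex R) := ~~ (`|z| <= toC lambda).
  have cQ : (#|[set i | Q (D 0%R i)]| <= 1)%N.
    rewrite cardE -[size _]count_predT.
    have -> : enum [set i | Q (D 0 i)] = [seq i <- enum 'I_n | Q (D 0 i)].
      by rewrite enumT /enum_mem; apply: eq_filter => i; rewrite !inE.
    rewrite count_predT size_filter -(count_map (fun i => D 0 i) Q).
    rewrite (permP Ds) /= (_ : count _ _ = 0%N) ?addn0 ?leq_b1 //.
    apply/eqP; rewrite -leqn0 leqNgt -has_count -all_predC; apply/allP => z.
    move=> /mapP[y /sl yl ->] /=; rewrite /Q negbK normc_def /= expr0n addr0.
    by rewrite sqrtr_sqr lecR.
  have [S0|[i0 i0S]] := set_0Vmem [set i | Q (D 0 i)].
    exists (Ordinal n0) => i _; apply: contraT => Qi.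
    by have : i \in [set i | Q (D 0 i)]; [rewrite inE | rewrite S0 inE].
  exists i0 => i; apply: contraNT => Qi.
  apply/eqP; have /card_le1_eqP h := cQ; apply: h; rewrite ?inE //.
  by move: i0S; rewrite inE.
pose one : 'cV[R]_n := const_mx 1.
pose u := P *m map_mx toC one; pose y := P *m map_mx toC x.
have tC m (z : 'cV[R]_m) : (map_mx toC z)^t* = map_mx toC z^T.
  apply/matrixP => i j; rewrite !mxE; apply/eqP; rewrite eq_complex /= oppr0.
  by rewrite !eqxx.
have dotE (z1 z2 : 'cV[R]_n) :
    toC ((z1^T *m z2) 0 0) = ((P *m map_mx toC z1)^t* *m (P *m map_mx toC z2)) 0 0.
  have -> : (P *m map_mx toC z1)^t* *m (P *m map_mx toC z2)
    = (map_mx toC z1)^t* *m (P^t* *m P) *m map_mx toC z2.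
    by rewrite trmx_mul map_mxM /= !mulmxA.
  by rewrite Pv mulmx1 tC -map_mxM [RHS]mxE.
have normE (z : 'cV[R]_n) : toC (\sum_i z i 0 ^+ 2)
    = \sum_i `|(P *m map_mx toC z) i 0| ^+ 2.
  have -> : \sum_i z i 0 ^+ 2 = (z^T *m z) 0 0.
    by rewrite mxE; apply: eq_bigr => i _; rewrite mxE -expr2.
  by rewrite dotE mxE; apply: eq_bigr => i _; rewrite normCK mulrC; congr (_ * _); rewrite !mxE.
have quadE : toC ((x^T *m A *m x) 0 0) = \sum_i D 0 i * `|y i 0| ^+ 2.
  have -> : toC ((x^T *m A *m x) 0 0) = (map_mx toC (x^T *m A *m x)) 0 0 by rewrite [RHS]mxE.
  rewrite !map_mxM -/Ac AE invmx_unitary // -tC.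
  have -> : (map_mx toC x)^t* *m (P^t* *m diag_mx D *m P) *m map_mx toC x
    = y^t* *m (diag_mx D *m y).
    by rewrite /y trmx_mul map_mxM /= !mulmxA.
  rewrite mxE; apply: eq_bigr => i _; rewrite mul_diag_mx [X in _ * X]mxE.
  rewrite mulrCA normCK; congr (_ * _); rewrite mulrC; congr (_ * _).
  by rewrite !mxE.
have Du : diag_mx D *m u = toC d *: u.
  have PA : diag_mx D *m P = P *m Ac.
    by rewrite AE !mulmxA mulmxV ?mul1mx // unitarymx_unit.
  by rewrite /u mulmxA PA -mulmxA -map_mxM Ad map_mxZ scalemxAr.
have DuE i : D 0 i * u i 0 = toC d * u i 0.
  by have /matrixP /(_ i 0) := Du; rewrite mul_diag_mx mxE [X in _ = X]mxE.
have ui i : i != i0 -> u i 0 = 0.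
  move=> /Di0 Dl; move/eqP: (DuE i); rewrite -subr_eq0 -mulrBl mulf_eq0 => /orP[|/eqP//].
  rewrite subr_eq0 => /eqP Dd; move: Dl; rewrite Dd normc_def /= expr0n addr0.
  by rewrite sqrtr_sqr lecR => h; have := le_lt_trans (le_trans (ler_norm _) h) ld; rewrite ltxx.
have nu : `|u i0 0| ^+ 2 = n%:R.
  have := normE one; rewrite -/u [X in _ = X](bigD1 i0) //= [X in _ = _ + X]big1 ?addr0.
    move=> <-; rewrite -(rmorph_nat toC); congr (toC _).
    under eq_bigr do rewrite mxE expr1n.
    by rewrite sumr_const cardT size_enum_ord.
  by move=> i /ui ->; rewrite normr0 expr0n.
have Di0d : D 0 i0 = toC d.
  move/eqP: (DuE i0); rewrite -subr_eq0 -mulrBl mulf_eq0 subr_eq0 => /orP[/eqP//|/eqP u0].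
  move: nu; rewrite u0 normr0 expr0n /= => /eqP.
  by rewrite eq_sym pnatr_eq0 -leqn0 leqNgt n0.
have sx : toC ((\sum_i x i 0) ^+ 2 / n%:R) = `|y i0 0| ^+ 2.
  have sE : toC (\sum_i x i 0) = (u i0 0)^* * y i0 0.
    have -> : \sum_i x i 0 = (one^T *m x) 0 0.
      by rewrite mxE; apply: eq_bigr => i _; rewrite !mxE mul1r.
    have uE i : (u^t*) 0 i = (u i 0)^* by rewrite [LHS]mxE; congr (_ ^* ); rewrite [LHS]mxE.
    rewrite dotE -/u -/y mxE (bigD1 i0) //= uE big1 ?addr0 // => i /ui h.
    by rewrite uE h conjC0 mul0r.
  rewrite rmorphM /= fmorphV rmorph_nat -nu.
  have -> : toC ((\sum_i x i 0) ^+ 2) = `|toC (\sum_i x i 0)| ^+ 2.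
    rewrite normc_def /= expr0n addr0 sqrtr_sqr -rmorphXn /=.
    by rewrite real_normK // num_real.
  rewrite sE normrM norm_conjC exprMn mulrAC divff ?mul1r //.
  by rewrite nu pnatr_eq0 -lt0n.
have H1 : toC ((x^T *m A *m x) 0 0 - d * (\sum_i x i 0) ^+ 2 / n%:R)
  = \sum_(i | i != i0) D 0 i * `|y i 0| ^+ 2.
  rewrite rmorphB /= quadE -mulrA rmorphM /= sx (bigD1 i0) //= Di0d.
  by rewrite addrAC subrr add0r.
have H2 : toC (\sum_i x i 0 ^+ 2 - (\sum_i x i 0) ^+ 2 / n%:R)
  = \sum_(i | i != i0) `|y i 0| ^+ 2.
  by rewrite rmorphB /= normE sx -/y (bigD1 i0) //= addrAC subrr add0r.
apply: complex_norm_le; rewrite rmorphM /= H1 H2 mulr_sumr.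
apply: le_trans (ler_norm_sum _ _ _) _; apply: ler_sum => i /Di0 Dl.
by rewrite normrM normrX normr_id ler_wpM2r // exprn_ge0.
Qed.
End Spectral.

(** * Edge counts in graphs with a spectral gap *)

Section Mixing.
Variables (R : realType) (n d : nat) (lambda : R) (G : rel 'I_n).
Hypothesis ndlG : ndl_graph d lambda G.
Hypothesis n_ge2 : (1 < n)%N.
Hypothesis lambda_lt_d : lambda < d%:R.
Local Notation E := (edges G).
Implicit Types (A S T : {set 'I_n}).

Let symG : symmetric G. Proof. by case: ndlG => -[]. Qed.
Let irrG : irreflexive G. Proof. by case: ndlG => -[]. Qed.
Let regG v : #|[set w | G v w]| = d. Proof. by case: ndlG. Qed.

Lemma edges_pair u v : ([set u; v] \in E) = G u v.
Proof.
apply/imsetP/idP => [[[a b]]|Guv]; last by exists (u, v); rewrite ?inE.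
rewrite inE /= => Gab eq_uv.
have ab : a != b by apply: contraTneq Gab => ->; rewrite irrG.
have uv : u != v.
  apply: contraNneq ab => uv; move: eq_uv; rewrite uv setUid => eq_v.
  have : a \in [set v] by rewrite eq_v !inE eqxx.
  have : b \in [set v] by rewrite eq_v !inE eqxx orbT.
  by rewrite !inE => /eqP -> /eqP ->.
have : u \in [set a; b] by rewrite -eq_uv !inE eqxx.
have : v \in [set a; b] by rewrite -eq_uv !inE eqxx orbT.
rewrite !inE => /orP[]/eqP v_ /orP[]/eqP u_; move: uv; rewrite u_ v_ ?eqxx //.
by rewrite symG.
Qed.

Lemma edgesP f : reflect (exists u v, f = [set u; v] /\ G u v) (f \in E).
Proof.
apply: (iffP imsetP) => [[[u v]]|[u [v [-> Guv]]]].
  by rewrite inE => Guv ->; exists u, v.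
by exists (u, v); rewrite ?inE.
Qed.

(** An edge at v is determined by its other end. *)
Lemma degree_edges v : (#|[set f in E | v \in f]| <= d)%N.
Proof.
rewrite -(regG v); apply: leq_trans (leq_imset_card (fun w => [set v; w]) _).
apply: subset_leq_card; apply/subsetP => f; rewrite inE => /andP[].
move=> /edgesP[a [b [-> Gab]]]; rewrite !inE => /orP[]/eqP->.
  by apply/imsetP; exists b; rewrite ?inE.
by apply/imsetP; exists a; rewrite ?inE 1?symG // setUC.
Qed.

Lemma card_edges : (#|E| <= n * d)%N.
Proof.
have -> : (n * d = \sum_(v : 'I_n) d)%N by rewrite sum_nat_const card_ord.
apply: (@leq_trans (\sum_(v : 'I_n) #|[set f in E | v \in f]|)); last first.
  by apply: leq_sum => v _; apply: degree_edges.
apply: (@leq_trans #|\bigcup_(v : 'I_n) [set f in E | v \in f]|).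
  apply: subset_leq_card; apply/subsetP => f fE; have /edgesP[a [b [fab _]]] := fE.
  by apply/bigcupP; exists a => //; rewrite inE fE fab !inE eqxx.
elim/big_rec2: _ => [|v m X _ IH]; first by rewrite cards0.
by rewrite (leq_trans (leq_card_setU _ _)) // leq_add2l.
Qed.

(** For disjoint S and T an edge between them has a well defined end in S. *)
Lemma card_cut S T : [disjoint S & T] ->
  #|cut E S T| = (\sum_(u in S) #|[set v in T | G u v]|)%N.
Proof.
move=> dST; pose P := [set x : 'I_n * 'I_n | [&& x.1 \in S, x.2 \in T & G x.1 x.2]].
have -> : cut E S T = [set [set x.1; x.2] | x in P].
  apply/setP => f; apply/cutP/imsetP.
    move=> [u [v [uS vT -> ]]]; rewrite edges_pair => Guv.
    by exists (u, v) => //; rewrite inE /= uS vT.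
  move=> [[u v]]; rewrite inE /= => /and3P[uS vT Guv] ->; exists u, v.
  by rewrite edges_pair.
rewrite card_in_imset.
  rewrite -sum1_card; under [RHS]eq_bigr do rewrite -sum1_card.
  rewrite pair_big_dep /=; apply: eq_bigl => -[u v]; rewrite !inE /=.
  by [].
move=> [u v] [u' v']; rewrite !inE /= => /and3P[uS vT _] /and3P[u'S v'T _] eq_f.
have : u \in [set u'; v'] by rewrite -eq_f !inE eqxx.
rewrite !inE => /orP[/eqP uu'|/eqP uv']; last first.
  by move: (disjointFr dST uS); rewrite uv' v'T.
have : v \in [set u'; v'] by rewrite -eq_f !inE eqxx orbT.
rewrite !inE => /orP[/eqP vu'|/eqP ->]; last by rewrite uu'.
by move: (disjointFr dST u'S); rewrite -vu' vT.
Qed.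

Let lambda_ge0 : 0 <= lambda.
Proof. by case: ndlG => _ _ [s [_ _ ->]]; rewrite le_max normr_ge0. Qed.

Lemma adjacency_bound (x : 'I_n -> R) :
  `|\sum_i \sum_j (G i j)%:R * x i * x j - d%:R * (\sum_i x i) ^+ 2 / n%:R|
  <= lambda * (\sum_i x i ^+ 2 - (\sum_i x i) ^+ 2 / n%:R).
Proof.
have [_ _ [s [[s_sorted cpE] s0 lE]]] := ndlG.
have sz_s : size s = n.
  apply: succn_inj; rewrite -(size_prod_XsubC s id) -cpE.
  exact: size_char_poly.
have sE : s = d%:R :: behead s.
  by move: s0 sz_s; case: (s) n_ge2 => [|y s'] n2 /= => [_ z|-> //]; rewrite -z in n2.
pose A : 'M[R]_n := adjacency_mx R G; pose c : 'cV[R]_n := \col_i x i.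
have AT : A^T = A by apply/matrixP => i j; rewrite !mxE symG.
have Ad : A *m const_mx 1 = d%:R *: const_mx 1 :> 'cV_n.
  apply/matrixP => i j; rewrite !mxE mulr1 -(regG i) -sum1_card natr_sum.
  rewrite [RHS]big_mkcond; apply: eq_bigr => k _; rewrite !mxE mulr1 inE.
  by case: (G i k).
have sl y : y \in behead s -> `|y| <= lambda.
  move=> /(nthP 0)[j]; rewrite size_behead sz_s nth_behead => ltin <-.
  have hi : (j.+1 < n)%N by rewrite -ltn_predRL.
  have h1 : s`_j.+1 <= s`_1.
    by apply: (sorted_leq_nth ge_trans ge_refl) s_sorted _ _ _ _ _;
      rewrite ?inE ?sz_s.
  have h2 : s`_n.-1 <= s`_j.+1.
    apply: (sorted_leq_nth ge_trans ge_refl) s_sorted _ _ _ _ _;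
      rewrite ?inE ?sz_s ?ltn_predL //; first by apply: ltn_trans n_ge2.
  rewrite lE ler_norml; apply/andP; split; last first.
    by rewrite le_max (le_trans h1 (ler_norm _)).
  rewrite lerNl le_max; apply/orP; right; rewrite -normrN.
  by apply: le_trans (ler_norm _); rewrite lerN2.
have := @quadratic_form_bound R n A (behead s) d%:R lambda c (ltnW n_ge2) AT Ad.
rewrite -sE => /(_ cpE sl lambda_lt_d).
have -> : \sum_i c i 0 = \sum_i x i by apply: eq_bigr => i _; rewrite mxE.
have -> : \sum_i c i 0 ^+ 2 = \sum_i x i ^+ 2 by apply: eq_bigr => i _; rewrite mxE.
have -> // : (c^T *m A *m c) 0 0 = \sum_i \sum_j (G i j)%:R * x i * x j.
rewrite mxE; under eq_bigr do rewrite mxE mulr_suml.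
rewrite exchange_big /=; apply: eq_bigr => i _; apply: eq_bigr => j _.
by rewrite !mxE [x i * _]mulrC.
Qed.

Definition ecount S T : R := \sum_(u in S) \sum_(v in T) (G u v)%:R.

Lemma ecountE S T : ecount S T = (\sum_(u in S) #|[set v in T | G u v]|)%:R.
Proof.
rewrite natr_sum; apply: eq_bigr => u _; rewrite -sum1_card natr_sum.
rewrite big_mkcond [RHS]big_mkcond; apply: eq_bigr => v _; rewrite !inE.
by case: (v \in T); case: (G u v).
Qed.

(** Polarization: four times the number of edges between S and T is the
    difference of the values of the quadratic form at 1_S + 1_T and 1_S - 1_T,
    and these two vectors have the same norm. *)
Lemma mixing S T : [disjoint S & T] ->
  d%:R * #|S|%:R * #|T|%:R / n%:R - lambda * (#|S|%:R + #|T|%:R) / 2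
  <= #|cut E S T|%:R.
Proof.
move=> dST; rewrite card_cut // -ecountE.
pose x (c : R) (i : 'I_n) : R := (i \in S)%:R + c * (i \in T)%:R.
have sumE A : \sum_(i : 'I_n) (i \in A)%:R = #|A|%:R :> R.
  by rewrite -sum1_card natr_sum [RHS]big_mkcond; apply: eq_bigr => i _; case: (_ \in _).
have sx c : \sum_i x c i = #|S|%:R + c * #|T|%:R.
  by rewrite big_split /= -mulr_sumr !sumE.
have sx2 c : \sum_i x c i ^+ 2 = #|S|%:R + c ^+ 2 * #|T|%:R.
  rewrite -!sumE mulr_sumr -big_split /=; apply: eq_bigr => i _; rewrite /x.
  have := disjointFr dST (x := i); case: (i \in S); case: (i \in T) => h.
  - by have := h isT.
  - by rewrite /=; ring.
  - by rewrite /=; ring.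
  - by rewrite /=; ring.
have qx c : \sum_i \sum_j (G i j)%:R * x c i * x c j
  = ecount S S + 2 * c * ecount S T + c ^+ 2 * ecount T T.
  have bE A A' : ecount A A' = \sum_i \sum_j (G i j)%:R * (i \in A)%:R * (j \in A')%:R.
    rewrite /ecount [LHS]big_mkcond; apply: eq_bigr => i _.
    case: (i \in A); last by rewrite big1 // => j _; rewrite mulr0 mul0r.
    rewrite big_mkcond; apply: eq_bigr => j _.
    by case: (j \in A'); rewrite !(mulr1, mulr0).
  have -> : 2 * c * ecount S T = c * ecount S T + c * ecount T S.
    suff -> : ecount T S = ecount S T by ring.
    rewrite !bE exchange_big; apply: eq_bigr => i _; apply: eq_bigr => j _.
    by rewrite symG mulrAC.
  rewrite !bE !mulr_sumr -!big_split /=; apply: eq_bigr => i _.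
  rewrite !mulr_sumr -!big_split /=; apply: eq_bigr => j _.
  rewrite /x; move: (_ \in S)%:R (_ \in T)%:R => a b; ring.
have := (adjacency_bound (x 1), adjacency_bound (x (- 1))).
rewrite !qx !sx !sx2 !ler_norml => -[/andP[h1 _] /andP[_ h2]].
have n0 : 0 < n%:R :> R by rewrite ltr0n ltnW.
have g1 : 0 <= lambda * (#|S|%:R + #|T|%:R) ^+ 2 / n%:R.
  by apply: mulr_ge0; rewrite ?invr_ge0 ?ler0n //; apply: mulr_ge0; rewrite ?sqr_ge0.
have g2 : 0 <= lambda * (#|S|%:R - #|T|%:R) ^+ 2 / n%:R.
  by apply: mulr_ge0; rewrite ?invr_ge0 ?ler0n //; apply: mulr_ge0; rewrite ?sqr_ge0.
move: h1 h2 g1 g2; move: (n%:R^-1) => ni.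
move: (ecount S S) (ecount S T) (ecount T T) => x1 x2 x3.
by lra.
Qed.

(** The mixing estimate for A and its complement has an error of order lambda n,
    which is useless for small A. Counting instead the edges inside A gives an
    error proportional to the size of A. *)
Lemma boundary_ge A :
  d%:R * #|A|%:R - d%:R * #|A|%:R ^+ 2 / n%:R - lambda * #|A|%:R
  <= #|cut E A (~: A)|%:R.
Proof.
have dA : [disjoint A & ~: A] by rewrite -setI_eq0 setICr.
rewrite card_cut // -ecountE.
pose x (i : 'I_n) : R := (i \in A)%:R.
have sumE (B : {set 'I_n}) : \sum_(i : 'I_n) (i \in B)%:R = #|B|%:R :> R.
  by rewrite -sum1_card natr_sum [RHS]big_mkcond; apply: eq_bigr => i _; case: (_ \in _).
have sx : \sum_i x i = #|A|%:R by rewrite sumE.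
have sx2 : \sum_i x i ^+ 2 = #|A|%:R.
  by rewrite -sumE; apply: eq_bigr => i _; rewrite /x; case: (_ \in _); rewrite ?expr1n ?expr0n.
have qx : \sum_i \sum_j (G i j)%:R * x i * x j = d%:R * #|A|%:R - ecount A (~: A).
  have -> : d%:R * #|A|%:R = ecount A setT.
    rewrite ecountE -natrM mulnC -sum_nat_const; congr (_%:R).
    by apply: eq_bigr => u _; rewrite -(regG u); apply: eq_card => v; rewrite !inE.
  rewrite /ecount -sumrB [RHS]big_mkcond; apply: eq_bigr => i _; rewrite /x.
  case: (i \in A); last by rewrite big1 // => j _; rewrite mulr0 mul0r.
  rewrite [X in _ = _ - X]big_mkcond [X in _ = X - _]big_mkcond -sumrB.
  apply: eq_bigr => j _; rewrite !inE.
  by case: (j \in A); rewrite !(mulr1, mulr0) ?subr0 ?subrr.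
have := adjacency_bound x; rewrite qx sx sx2 ler_norml => /andP[_ h].
have n0 : 0 < n%:R :> R by rewrite ltr0n ltnW.
have g1 : 0 <= lambda * #|A|%:R ^+ 2 / n%:R.
  by apply: mulr_ge0; rewrite ?invr_ge0 ?ler0n //; apply: mulr_ge0; rewrite ?sqr_ge0.
move: h g1; move: (n%:R^-1) (ecount _ _) => ni y.
by lra.
Qed.

(** The two ends of an edge have at most 2 (d - 1) boundary edges, which
    [boundary_ge] allows only if lambda is not small. Hence a small ratio
    lambda / d forces d to be large. *)
Lemma degree_lower : (0 < d)%N -> 1 <= 2 * d%:R / n%:R + lambda.
Proof.
move=> d0; pose u := Ordinal (ltnW n_ge2).
have /card_gt0P[v] : (0 < #|[set w | G u w]|)%N by rewrite regG.
rewrite inE => Guv; have uv : u != v by apply: contraTneq Guv => <-; rewrite irrG.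
have := boundary_ge [set u; v]; rewrite cards2 uv /=.
have c2 : (#|cut E [set u; v] (~: [set u; v])| <= d.-1 + d.-1)%N.
  pose t w := [set f in E | w \in f] :\ [set u; v].
  have tle w : w \in [set u; v] -> (#|t w| <= d.-1)%N.
    move=> wuv; have := degree_edges w; rewrite (cardsD1 [set u; v]).
    by rewrite inE edges_pair Guv wuv add1n -[X in (X <= _)%N -> _]/(_.+1); case: (d) d0.
  apply: (@leq_trans #|t u :|: t v|); last first.
    apply: leq_trans (leq_card_setU _ _) _.
    by rewrite leq_add ?tle // !inE eqxx ?orbT.
  apply: subset_leq_card; apply/subsetP => f /cutP[a [b [aA bA fE fE']]].
  have fuv : f != [set u; v].
    apply: contraTneq bA => fuv; rewrite inE negbK -fuv fE !inE eqxx orbT //.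
  have af : a \in f by rewrite fE !inE eqxx.
  by move: aA; rewrite !inE fuv fE' /= => /orP[]/eqP<-; rewrite af ?orbT.
have : (#|cut E [set u; v] (~: [set u; v])|%:R : R) <= (d.-1 + d.-1)%:R by rewrite ler_nat.
have -> : (d.-1 + d.-1)%:R = 2 * d%:R - 2 :> R.
  by rewrite -[in RHS](prednK d0) natrD -natr1; ring.
move: (#|_|%:R) (n%:R^-1) => c ni h1 h2.
by move: (le_trans h2 h1); lra.
Qed.

End Mixing.

(** * Large components and high degrees *)

Section Statistics.
Variables (R : realType) (n : nat).
Implicit Types (A S T W : {set 'I_n}) (F U E : {set {set 'I_n}}) (v : 'I_n).

Definition big K F := [set v | (K <= #|component (edge_rel F) v|)%N].

Definition degree F v := #|[set f in F | v \in f]|.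

(** The total degree of the vertices of degree more than D. One edge changes it
    by at most 2 (D + 1), so it is concentrated, and it controls how many edges
    a given number of vertices can meet. *)
Definition heavy_degree D F :=
  (\sum_v (if D < degree F v then degree F v else 0))%N.

Lemma component_sub F F' v : F \subset F' ->
  component (edge_rel F) v \subset component (edge_rel F') v.
Proof.
move=> /subsetP FF'; rewrite -!reach_component; apply: reach_min (sub_reach _ _) _.
by move=> a b ab; apply: reach_closed; apply: FF'.
Qed.

Lemma edge_rel_sym F : connect_sym (edge_rel F).
Proof. by apply: sym_connect_sym => u v; apply: edge_relC. Qed.

Lemma mem_component F v : v \in component (edge_rel F) v.
Proof. by rewrite inE connect0. Qed.

Lemma component_eq F v w : w \in component (edge_rel F) v ->
  component (edge_rel F) w = component (edge_rel F) v.
Proof.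
rewrite inE => vw; apply/setP => x; rewrite !inE.
by rewrite (same_connect (edge_rel_sym F) vw).
Qed.

Lemma big_sub K F F' : F \subset F' -> big K F \subset big K F'.
Proof.
move=> FF'; apply/subsetP => v; rewrite !inE => /leq_trans -> //.
exact/subset_leq_card/component_sub.
Qed.

(** The vertices whose component becomes large were connected to an end of the
    new edge, and the component of that end had fewer than K vertices. *)
Lemma big_add_edge K F a b :
  (#|big K ([set a; b] |: F)| <= #|big K F| + K.*2)%N.
Proof.
set F' := _ |: F; pose C v := component (edge_rel F) v.
have sub : big K F' \subset big K F :|:
    ((if #|C a| < K then C a else set0) :|: (if #|C b| < K then C b else set0))%N.
  apply/subsetP => v; rewrite !in_setU [v \in big K F]inE.
  have [vK|vK] := leqP K #|C v|; first by [].
  rewrite inE => vK'.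
  have aE w : (v \in if (#|C w| < K)%N then C w else set0) = (v \in C w).
    case: ifPn => //; rewrite inE -leqNgt => Kw; apply/esym/negP => vw.
    by move: vK; rewrite /C (component_eq vw) ltnNge Kw.
  rewrite !aE /=; apply: contraLR vK' => nab; rewrite -ltnNge.
  apply: leq_ltn_trans vK; apply: subset_leq_card.
  rewrite /C -!reach_component; apply: reach_min (sub_reach _ _) _.
  rewrite reach_component => x y; rewrite /edge_rel /= in_setU1.
  move=> /orP[/eqP xy|xy] xv; last first.
    by move: xv; rewrite -reach_component; apply: reach_closed.
  suff : x \notin [set a; b] by rewrite -xy !inE eqxx.
  apply: contra nab => xab.
  have vx : v \in C x by rewrite /C (component_eq xv) mem_component.
  by move: xab; rewrite in_set2 => /orP[]/eqP <-; rewrite vx ?orbT.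
apply: leq_trans (subset_leq_card sub) _.
apply: leq_trans (leq_card_setU _ _) _; rewrite leq_add2l.
apply: leq_trans (leq_card_setU _ _) _; rewrite -addnn leq_add //.
  by case: ifP => [/ltnW|]; rewrite ?cards0.
by case: ifP => [/ltnW|]; rewrite ?cards0.
Qed.

Lemma big_flip K F a b :
  `|#|big K ([set a; b] |: F)|%:R - #|big K F|%:R| <= (2 * K)%:R :> R.
Proof.
have h1 : (#|big K F| <= #|big K ([set a; b] |: F)|)%N.
  by apply: subset_leq_card; apply: big_sub; apply: subsetUr.
rewrite -natrB // normr_nat ler_nat leq_subLR mul2n.
exact: big_add_edge.
Qed.

Lemma heavy_flip D F (e : {set 'I_n}) : (#|e| <= 2)%N ->
  `|(heavy_degree D (e |: F))%:R - (heavy_degree D F)%:R| <= (2 * D.+1)%:R :> R.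
Proof.
move=> e2; have [eF|eF] := boolP (e \in F).
  have -> : e |: F = F by apply/setUidPr; rewrite sub1set.
  by rewrite subrr normr0 ler0n.
have degE v : degree (e |: F) v = ((v \in e) + degree F v)%N.
  rewrite /degree; have [ve|ve] := boolP (v \in e).
    rewrite (_ : [set f in e |: F | v \in f] = e |: [set f in F | v \in f]).
      by rewrite cardsU1 inE (negbTE eF).
    by apply/setP => f; rewrite !inE; case: eqVneq => // ->.
  rewrite add0n; apply: eq_card => f; rewrite !inE.
  by case: eqVneq => // ->; rewrite (negbTE ve) !andbF.
have h1 : (heavy_degree D F <= heavy_degree D (e |: F))%N.
  apply: leq_sum => v _; rewrite degE.
  by case: (ltnP D (degree F v)) => // h; rewrite ltn_addl // leq_addl.
have h2 : (heavy_degree D (e |: F) <= heavy_degree D F + 2 * D.+1)%N.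
  apply: (@leq_trans (heavy_degree D F + \sum_(v in e) D.+1)%N); last first.
    by rewrite leq_add2l sum_nat_const leq_mul2r e2 orbT.
  rewrite [X in (_ <= _ + X)%N]big_mkcond -big_split /=; apply: leq_sum => v _.
  rewrite degE; case: (v \in e); last by rewrite add0n addn0.
  rewrite add1n; case: (ltnP D (degree F v)) => h.
    by rewrite ltnS (ltnW h) -addn1 leq_add2l.
  by case: ifP => // h'; rewrite add0n ltnS.
by rewrite -natrB // normr_nat ler_nat leq_subLR.
Qed.

Lemma expect_big p E K :
  expect p E (fun F => #|big K F|%:R)
  = \sum_v (1 - prob p E (fun F => (#|reach F [set v]| < K)%N)) :> R.
Proof.
under eq_expect => F _.
  rewrite -sum1_card natr_sum big_mkcond /=.
  over.
rewrite expect_sum; apply: eq_bigr => v _.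
rewrite (@eq_expect _ _ _ _ (fun F => if v \in big K F then 1 else 0)
   (fun F => 1 + (-1) * (#|reach F [set v]| < K)%N%:R)) => [|F _].
  by rewrite expectD expect_cst expectZ mulN1r.
rewrite inE -reach_component; case: ltnP => _ /=; last by rewrite mulr0 addr0.
by rewrite mulr1 subrr.
Qed.

(** Since x <= 2^x, a degree x > D is at most 4^x / 2^D, and the expectation of
    4^x factors over the edges at the vertex. *)
Lemma expect_heavy p E D d : 0 <= p <= 1 ->
  (forall v, (degree E v <= d)%N) ->
  expect p E (fun F => (heavy_degree D F)%:R)
  <= n%:R * (1 + 3 * p) ^+ d / 2 ^+ D :> R.
Proof.
move=> p01 degE; have /andP[p0 p1] := p01.
rewrite (@eq_expect _ _ _ _ _ (fun F => \sum_v
   (if (D < degree F v)%N then degree F v else 0)%:R)); last first.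
  by move=> F _; rewrite /heavy_degree natr_sum.
rewrite expect_sum.
have -> : n%:R * (1 + 3 * p) ^+ d / 2 ^+ D = \sum_(v : 'I_n) (1 + 3 * p) ^+ d / 2 ^+ D.
  by rewrite sumr_const card_ord -mulrA mulr_natl.
apply: ler_sum => v _.
pose B := [set f in E | v \in f].
apply: (@le_trans _ _ (expect p E (fun F => 2 ^- D * 4 ^+ #|F :&: B|))).
  apply: le_expect => // F FE.
  have <- : degree F v = #|F :&: B|.
    apply: eq_card => f; rewrite !inE; case: (boolP (f \in F)) => //= fF.
    by rewrite (subsetP FE).
  case: ifP => [Dv|_]; last by rewrite mulr_ge0 ?invr_ge0 ?exprn_ge0.
  rewrite ler_pdivlMl ?exprn_gt0 // -natrX -natrX -natrM ler_nat.
  apply: (@leq_trans (2 ^ degree F v * 2 ^ degree F v)); last by rewrite -expnMn.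
  by rewrite leq_mul ?leq_pexp2l // ltnW // ltn_expl.
rewrite expectZ expect_exp_card mulrC ler_pM2r ?invr_gt0 ?exprn_gt0 //.
have -> : 1 - p + p * 4 = 1 + 3 * p by ring.
apply: ler_weXn2l; first by lra.
by apply: leq_trans (degE v); apply: subset_leq_card; rewrite subsetIr.
Qed.

End Statistics.

(** * Counting sparse cuts *)

Section UnionBound.
Variables (R : realType) (n : nat).
Implicit Types (A S T W : {set 'I_n}) (F U E : {set {set 'I_n}}) (v : 'I_n).

(** Up to scaling, the expectation of x^#|C| for a uniform random subset C. *)
Lemma sum_powerset_card (T : finType) (U : {set T}) (x : R) :
  \sum_(C in powerset U) x ^+ #|C| = (1 + x) ^+ #|U|.
Proof.
have := expect_exp_card (2^-1) U U x; rewrite setIid /expect.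
have -> : 1 - 2^-1 + 2^-1 * x = 2^-1 * (1 + x) by lra.
rewrite exprMn => h; apply: (@mulfI _ (2^-1 ^+ #|U|)).
  by rewrite expf_neq0 // invr_eq0 pnatr_eq0.
rewrite -h mulr_sumr; apply: eq_bigr => C; rewrite inE => CU.
rewrite (setIidPl CU); congr (_ * _); rewrite -prodr_const.
by apply: eq_bigr => e _; case: ifP => // _; lra.
Qed.

(** One representative for each component with at least K vertices. *)
Definition roots K F := [set v in big K F | fingraph.root (edge_rel F) v == v].

Lemma card_roots K F : (0 < K)%N -> (#|roots K F| <= n %/ K)%N.
Proof.
move=> K0; rewrite leq_divRL // -sum_nat_const.
apply: (@leq_trans (\sum_(v in roots K F) #|component (edge_rel F) v|)).
  by apply: leq_sum => v; rewrite !inE => /andP[].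
under eq_bigr do rewrite -sum1_card big_mkcond /=.
rewrite exchange_big /= -[leqRHS](card_ord n) -sum1_card; apply: leq_sum => w _.
rewrite -big_mkcondr sum1_card -(cards1 (fingraph.root (edge_rel F) w)).
apply: subset_leq_card; apply/subsetP => r; rewrite unfold_in !inE.
move=> /andP[/andP[_ /eqP rr] rw]; apply/eqP.
by rewrite -rr; apply/eqP; rewrite (root_connect (edge_rel_sym F)).
Qed.

Lemma cut_closed F S W : edge_closed F W -> S \subset W ->
  cut F S (W :\: S) = cut F S (~: S).
Proof.
move=> FW SW; apply/setP => f; apply/cutP/cutP => -[u [v [uS vT fE fF]]].
  by exists u, v; move: vT; rewrite !inE => /andP[].
exists u, v; split => //; move: vT; rewrite !inE => -> /=.
by apply: (FW u v); rewrite ?(subsetP SW) // /edge_rel /= -fE.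
Qed.

Lemma big_closed K F : edge_closed F (big K F).
Proof.
move=> u v uv; rewrite !inE => uK; rewrite (component_eq (v := u)) //.
by rewrite inE connect1.
Qed.

Lemma mem_closed_component F A v w : edge_closed F A -> v \in A ->
  w \in component (edge_rel F) v -> w \in A.
Proof.
move=> FA vA; rewrite -reach_component; apply/subsetP.
by apply: reach_min FA; rewrite sub1set.
Qed.

(** Two sets with the same edge boundary disagree on a union of components, and
    this union contains no representative. *)
Lemma cut_roots_inj K F S S' : S \subset big K F -> S' \subset big K F ->
  cut F S (~: S) = cut F S' (~: S') -> S :&: roots K F = S' :&: roots K F ->
  S = S'.
Proof.
wlog suff : S S' / S \subset big K F -> cut F S (~: S) = cut F S' (~: S') ->
    S :&: roots K F = S' :&: roots K F -> S \subset S'.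
  move=> h SW S'W c r; apply/eqP; rewrite eqEsubset.
  by rewrite (h S S') ?(h S' S).
move=> SW ceq req; apply/subsetP => v vS; apply: contraT => vS'.
pose B := [set w | (w \in S) != (w \in S')].
have BF : edge_closed F B.
  move=> a b ab; rewrite !inE.
  have cE (X : {set _}) : ((a \in X) != (b \in X)) = ([set a; b] \in cut F X (~: X)).
    apply/idP/cutP => [|[x [y [xX yX fE fF]]]].
      case aX : (a \in X); case bX : (b \in X) => // _.
        by exists a, b; rewrite inE bX aX.
      by exists b, a; split; rewrite ?inE ?aX ?bX // setUC.
    have ax : x \in [set a; b] by rewrite fE !inE eqxx.
    have bx : y \in [set a; b] by rewrite fE !inE eqxx orbT.
    move: ax bx yX xX; rewrite !inE => /orP[]/eqP-> /orP[]/eqP-> => yX xX.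
    - by rewrite xX in yX.
    - by rewrite xX (negbTE yX).
    - by rewrite xX (negbTE yX).
    - by rewrite xX in yX.
  have := cE S'; rewrite -ceq -cE.
  by case: (a \in S); case: (b \in S); case: (a \in S'); case: (b \in S').
have vB : v \in B by rewrite inE vS (negbTE vS').
pose r := fingraph.root (edge_rel F) v.
have vr : connect (edge_rel F) v r by apply: connect_root.
have rB : r \in B.
  by apply: (mem_closed_component BF vB); rewrite inE.
have rR : r \in roots K F.
  rewrite inE root_root ?eqxx ?andbT; last exact: edge_rel_sym.
  apply: (mem_closed_component (@big_closed K F) (subsetP SW _ vS)).
  by rewrite inE.
move/setP: req => /(_ r); rewrite !in_setI rR !andbT => rS.
by move: rB; rewrite inE rS eqxx.
Qed.

(** A set S is encoded by its edge boundary and the representatives in S. Each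
    boundary C of at most s edges satisfies 1 <= x^(#|C| - s), and the sum of
    x^#|C| over all sets C of edges is a product. *)
Lemma card_small_cuts K F (s : nat) (x : R) : (0 < K)%N -> 0 < x <= 1 ->
  #|[set S : {set 'I_n} | (S \subset big K F) && (#|cut F S (~: S)| <= s)%N]|%:R
  <= x^-1 ^+ s * (1 + x) ^+ #|F| * 2 ^+ (n %/ K).
Proof.
move=> K0 /andP[x0 x1]; set Q := [set S | _].
pose h S := (cut F S (~: S), S :&: roots K F).
have hinj : {in Q &, injective h}.
  move=> S S'; rewrite !inE => /andP[SW _] /andP[S'W _] [c r].
  exact: cut_roots_inj c r.
have hQ : h @: Q \subset finset.setX (powerset F) (powerset (roots K F)).
  apply/subsetP => _ /imsetP[S SQ ->]; rewrite !inE subsetIr andbT.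
  by apply/subsetP => f; rewrite inE => /andP[].
apply: (@le_trans _ _ (\sum_(S in Q) x^-1 ^+ s * x ^+ #|(h S).1|)).
  rewrite -sum1_card natr_sum; apply: ler_sum => S; rewrite inE => /andP[_ cs].
  rewrite -(subnK cs) exprD -mulrA -exprMn mulVf ?gt_eqF // expr1n mulr1.
  by rewrite exprn_ege1 // invf_ge1.
rewrite -mulr_sumr -mulrA ler_pM2l ?exprn_gt0 ?invr_gt0 //.
rewrite -(big_imset (fun CR : {set {set 'I_n}} * {set 'I_n} => x ^+ #|CR.1|)) //=.
apply: (@le_trans _ _ (\sum_(CR in finset.setX (powerset F) (powerset (roots K F)))
   x ^+ #|CR.1|)).
  rewrite big_mkcond [leRHS]big_mkcond; apply: ler_sum => CR _.
  case: ifP => [/(subsetP hQ) ->//|_]; case: ifP => // _.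
  by rewrite exprn_ge0 // ltW.
rewrite (eq_bigl (fun CR : {set {set 'I_n}} * {set 'I_n} =>
    (CR.1 \in powerset F) && (CR.2 \in powerset (roots K F))));
  last by case=> C r; rewrite in_setX.
rewrite -(pair_big (mem (powerset F)) (mem (powerset (roots K F)))
   (fun C r => x ^+ #|C|)) /=.
under eq_bigr do rewrite sumr_const card_powerset -mulr_natr.
rewrite -mulr_suml sum_powerset_card ler_wpM2l ?exprn_ge0 ?addr_ge0 //; first exact: ltW.
by rewrite natrX ler_weXn2l ?card_roots // ler1n.
Qed.

Definition sparse_cut K (m : R) (s : nat) F1 F2 :=
  [exists S : {set 'I_n}, [&& S \subset big K F1, m <= #|S|%:R,
    m <= #|big K F1 :\: S|%:R &
    (#|cut (F1 :|: F2) S (big K F1 :\: S)| <= s)%N]].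

Lemma cut_setI E F S T : F \subset E -> cut F S T = F :&: cut E S T.
Proof.
move=> /subsetP FE; apply/setP => f; rewrite !inE.
by case: (boolP (f \in F)) => //= /FE ->.
Qed.

Lemma cutS F F' S T : F \subset F' -> cut F S T \subset cut F' S T.
Proof.
by move=> /subsetP FF'; apply/subsetP => f; rewrite !inE => /andP[/FF' -> ->].
Qed.

(** Union bound over the cuts that are sparse in the first round, which are few.
    The second round is independent of them, and has at most s edges in a cut
    of at least N edges with probability at most the expectation of 2^(s - X),
    where X is the number of retained edges. *)
Lemma sparse_cut_prob p1 p2 E K (m : R) s N (x : R) : (0 < K)%N -> 0 < x <= 1 ->
  0 <= p1 <= 1 -> 0 <= p2 <= 1 ->
  (forall S T, [disjoint S & T] -> m <= #|S|%:R -> m <= #|T|%:R ->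
     (N <= #|cut E S T|)%N) ->
  expect p1 E (fun F1 => prob p2 E (fun F2 => sparse_cut K m s F1 F2))
  <= x^-1 ^+ s * (1 + p1 * x) ^+ #|E| * 2 ^+ (n %/ K) * 2 ^+ s
     * (1 - p2 / 2) ^+ N.
Proof.
move=> K0 x01 p101 p201 cutE; have /andP[x0 x1] := x01.
have q0 : 0 <= 1 - p2 / 2 by lra.
have q1 : 1 - p2 / 2 <= 1 by lra.
apply: (@le_trans _ _ (expect p1 E (fun F1 => (x^-1 ^+ s * 2 ^+ (n %/ K) * 2 ^+ s
     * (1 - p2 / 2) ^+ N) * (1 + x) ^+ #|F1 :&: E|))); last first.
  rewrite expectZ expect_exp_card setIid.
  have -> : 1 - p1 + p1 * (1 + x) = 1 + p1 * x by ring.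
  have AC (a b c d e : R) : a * c * d * e * b = a * b * c * d * e by ring.
  by rewrite AC.
apply: le_expect => // F1 F1E; rewrite (setIidPl F1E).
pose W := big K F1.
pose Q := [set S : {set 'I_n} | (S \subset W) && (#|cut F1 S (~: S)| <= s)%N].
pose Q' := Q :&: [set S : {set 'I_n} | (m <= #|S|%:R) && (m <= #|W :\: S|%:R)].
apply: (@le_trans _ _ (expect p2 E (fun F2 =>
    \sum_(S in Q') 2 ^+ s * 2^-1 ^+ #|F2 :&: cut E S (W :\: S)|))).
  apply: le_expect => // F2 F2E.
  have pos S : 0 <= (2 ^+ s * 2^-1 ^+ #|F2 :&: cut E S (W :\: S)| : R).
    by rewrite mulr_ge0 ?exprn_ge0 // invr_ge0.
  case: (boolP (sparse_cut _ _ _ _ _)) => [|_]; last exact: sumr_ge0.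
  move=> /existsP[S /and4P[SW mS mWS cs]].
  have SQ' : S \in Q'.
    rewrite !inE SW mS mWS !andbT -(cut_closed (@big_closed K F1)) //.
    apply: leq_trans cs; apply: subset_leq_card; apply: cutS; exact: subsetUl.
  rewrite (bigD1 S) //=; apply: ler_wpDr; first exact: sumr_ge0.
  rewrite -(cut_setI _ _ F2E).
  have c2 : (#|cut F2 S (W :\: S)| <= s)%N.
    apply: leq_trans cs; apply: subset_leq_card; apply: cutS; exact: subsetUr.
  rewrite -(subnK c2) exprD -mulrA -exprMn divff ?pnatr_eq0 // expr1n mulr1.
  by rewrite exprn_ege1 // ler1n.
rewrite expect_sum.
apply: (@le_trans _ _ (\sum_(S in Q') 2 ^+ s * (1 - p2 / 2) ^+ N)).
  apply: ler_sum => S; rewrite !inE => /andP[/andP[SW _] /andP[mS mWS]].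
  rewrite expectZ expect_exp_card ler_pM2l ?exprn_gt0 //.
  have -> : 1 - p2 + p2 / 2 = 1 - p2 / 2 by lra.
  apply: ler_wiXn2l => //.
  have -> : E :&: cut E S (W :\: S) = cut E S (W :\: S).
    by apply/setIidPr; apply/subsetP => f; rewrite inE => /andP[].
  apply: cutE => //.
  by rewrite disjoint_sym -setI_eq0 setIDAC -setIDA setDv setI0.
rewrite sumr_const -[_ *+ #|_|]mulr_natl.
have cQ : #|Q'|%:R <= x^-1 ^+ s * (1 + x) ^+ #|F1| * 2 ^+ (n %/ K).
  apply: le_trans (card_small_cuts F1 s K0 x01); rewrite ler_nat.
  apply: subset_leq_card; rewrite -/Q; apply/subsetP => S.
  by rewrite in_setI => /andP[].
apply: (@le_trans _ _ (x^-1 ^+ s * (1 + x) ^+ #|F1| * 2 ^+ (n %/ K)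
   * (2 ^+ s * (1 - p2 / 2) ^+ N))).
  by rewrite ler_wpM2r // mulr_ge0 ?exprn_ge0.
have AC (a b c d e : R) : a * b * c * (d * e) = a * c * d * e * b by ring.
by rewrite AC.
Qed.

End UnionBound.

(** * From edge cuts to an expanding core *)

Section Pruning.
Variables (R : realType) (n : nat).
Implicit Types (A S T W X : {set 'I_n}) (F U E : {set {set 'I_n}}) (v : 'I_n).

Definition expands (H : rel 'I_n) (g : R) W :=
  forall S, S \subset W -> #|S|%:R <= #|W|%:R / 2 :> R ->
    g * #|S|%:R <= #|ext_nbhd H W S|%:R.

Lemma ext_nbhd_setU (H : rel 'I_n) W X S :
  ext_nbhd H W (X :|: S) \subset ext_nbhd H W X :|: ext_nbhd H (W :\: X) S.
Proof.
apply/subsetP => v; rewrite !inE negb_or => /andP[/andP[/andP[vX vS] vW]].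
rewrite vX vS vW /= => /exists_inP[u]; rewrite inE => /orP[uX|uS] Huv.
  by apply/orP; left; apply/exists_inP; exists u.
by apply/orP; right; apply/exists_inP; exists u.
Qed.

(** Only sets S for which S and W minus S both have at least m vertices are
    assumed to expand. A largest set X of at most half of W that does not
    expand has fewer than m vertices, and can be removed: a set that does not
    expand in the rest could be added to X, giving a larger set that does not
    expand, or one so large that it expands by hypothesis. *)
Lemma prune (H : rel 'I_n) (g m : R) W : 0 < g -> 0 < m -> 3 * m <= #|W|%:R ->
  (forall S, S \subset W -> m <= #|S|%:R -> m <= #|W :\: S|%:R ->
     g * #|S|%:R <= #|ext_nbhd H W S|%:R) ->
  exists2 W' : {set 'I_n}, W' \subset W /\ #|W|%:R - m <= #|W'|%:R & expands H g W'.
Proof.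
move=> g0 m0 mW Wexp.
(* The empty set satisfies only the weak inequality; P' below lets it serve as
   a default and asks all other sets for the strict one. *)
pose P X := [&& X \subset W, #|X|%:R <= #|W|%:R / 2 :> R &
               #|ext_nbhd H W X|%:R <= g * #|X|%:R].
have P0 : P set0.
  rewrite /P sub0set cards0 divr_ge0 ?ler0n //= mulr0.
  rewrite (_ : ext_nbhd _ _ _ = set0) ?cards0 //.
  by apply/setP => v; rewrite !inE; apply/negP => /andP[_ /exists_inP[u]]; rewrite inE.
pose P' X := P X && ((X == set0) || (#|ext_nbhd H W X|%:R < g * #|X|%:R)).
have P'0 : P' set0 by rewrite /P' P0 eqxx.
case: (arg_maxnP (fun X => #|X|) P'0) => X /andP[/and3P[XW X2 Xn] Xs] Xmax.
have cW S : S \subset W -> #|W :\: S|%:R = #|W|%:R - #|S|%:R :> R.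
  by move=> SW; rewrite cardsD (setIidPr SW) natrB // subset_leq_card.
have Xm : #|X|%:R < m.
  rewrite ltNge; apply/negP => mX; have := Wexp _ XW mX; rewrite cW // => h.
  move: Xs => /orP[/eqP X0|]; first by move: mX; rewrite X0 cards0; lra.
  by rewrite ltNge h //; lra.
exists (W :\: X); first by rewrite subsetDl cW //; split => //; lra.
move=> S SW' S2; rewrite leNgt; apply/negP => Sn.
have SW : S \subset W by apply: subset_trans SW' (subsetDl _ _).
have dXS : [disjoint X & S].
  rewrite disjoint_sym -setI_eq0; apply/eqP/setP => v; rewrite !inE.
  by apply/negP => /andP[/(subsetP SW')]; rewrite !inE => /andP[/negbTE->].
have cXS : #|X :|: S|%:R = #|X|%:R + #|S|%:R :> R.
  by rewrite cardsU (eqP (_ : X :&: S == set0)) ?setI_eq0 // cards0 subn0 natrD.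
have XSW : X :|: S \subset W by rewrite subUset XW.
have nXS : #|ext_nbhd H W (X :|: S)|%:R < g * #|X :|: S|%:R :> R.
  rewrite cXS mulrDr; apply: le_lt_trans (ler_ltD Xn Sn).
  rewrite -natrD ler_nat; apply: leq_trans (leq_card_setU _ _).
  exact/subset_leq_card/ext_nbhd_setU.
have S0 : 0 < #|S|%:R :> R.
  by rewrite -(pmulr_rgt0 _ g0); apply: le_lt_trans Sn.
move: S2; rewrite cW // => S2.
have [XS2|XS2] := leP (#|X :|: S|%:R : R) (#|W|%:R / 2).
  have : (#|X :|: S| <= #|X|)%N.
    by apply: Xmax; rewrite /P' /P XSW XS2 nXS ltW ?orbT.
  by rewrite -(ler_nat R) cXS; lra.
by move: nXS; rewrite ltNge Wexp // ?cW // ?cXS; lra.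
Qed.

(** The trace on W of a component and its complement in W have no outer
    neighbours; one of them is at most half of W, hence empty. *)
Lemma expands_connected F (g : R) W v : 0 < g -> expands (edge_rel F) g W ->
  v \in W -> W \subset component (edge_rel F) v.
Proof.
move=> g0 Wexp vW; pose C := component (edge_rel F) v.
have C0 S : S \subset W -> #|S|%:R <= #|W|%:R / 2 :> R ->
    ext_nbhd (edge_rel F) W S = set0 -> S = set0.
  move=> SW S2 NS; have := Wexp S SW S2; rewrite NS cards0 => h.
  by apply/eqP; rewrite -cards_eq0 -(pnatr_eq0 R) eq_le ler0n andbT -(pmulr_rle0 _ g0).
have cC a b : edge_rel F a b -> (a \in C) = (b \in C).
  move=> ab; rewrite !inE; apply: (same_connect_r (@edge_rel_sym n F)).
  exact: connect1.
have nIC : ext_nbhd (edge_rel F) W (W :&: C) = set0.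
  apply/setP => w; rewrite !inE -!/(_ \in C); apply/negP => /andP[/andP[nw wW]].
  move=> /exists_inP[u]; rewrite !inE => /andP[uW uC] /cC uw.
  by move: nw; rewrite wW /=; move: uw; rewrite !inE uC => <-.
have nDC : ext_nbhd (edge_rel F) W (W :\: C) = set0.
  apply/setP => w; rewrite !inE -!/(_ \in C); apply/negP => /andP[/andP[nw wW]].
  move=> /exists_inP[u]; rewrite !inE => /andP[uC uW] /cC uw.
  by move: nw; rewrite wW andbT negbK; move: uw; rewrite !inE (negbTE uC) => <-.
have card2 : #|W|%:R = #|W :&: C|%:R + #|W :\: C|%:R :> R by rewrite -natrD cardsID.
have [h|h] := leP (#|W :&: C|%:R : R) (#|W|%:R / 2).
  have /setP/(_ v) := C0 _ (subsetIl W C) h nIC.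
  by rewrite !inE vW connect0.
have WC0 : W :\: C = set0 by apply: (C0 _ (subsetDl W C) _ nDC); lra.
by rewrite -setD_eq0 WC0.
Qed.

(** Otherwise the largest component and the component of W would be disjoint
    and contain together at least twice as many vertices as W. *)
Lemma giant_contains F K L W v : largest_component (edge_rel F) L ->
  W \subset component (edge_rel F) v -> (K <= #|W|)%N ->
  (#|big K F| < #|W| + #|W|)%N -> W \subset L.
Proof.
move=> [[u ->] Lmax] WC KW bigW; set C := component _ v in WC *.
have [d|] := boolP [disjoint component (edge_rel F) u & C]; last first.
  rewrite -setI_eq0 => /set0Pn[w]; rewrite inE => /andP[wu wv].
  by rewrite -(component_eq wu) (component_eq wv).
have WC' := subset_leq_card WC; have CL := Lmax v.
move: bigW; rewrite ltnNge (leq_trans (leq_add WC' (leq_trans WC' CL))) //.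
rewrite addnC -cardsUI (eqP (_ : _ :&: _ == set0)) ?setI_eq0 // cards0 addn0.
apply: subset_leq_card; rewrite subUset; apply/andP; split; apply/subsetP => w ws.
  by rewrite inE (component_eq ws) (leq_trans KW) // (leq_trans WC').
by rewrite inE (component_eq ws) (leq_trans KW).
Qed.

(** Each crossing edge meets an outer neighbour of S, and all but the edges
    counted by [heavy_degree] are at most D per neighbour. *)
Lemma cut_le_nbhd F D W S : S \subset W ->
  (#|cut F S (W :\: S)| <= D * #|ext_nbhd (edge_rel F) W S| + heavy_degree D F)%N.
Proof.
move=> SW; set N := ext_nbhd _ _ _.
apply: (@leq_trans (\sum_(v in N) degree F v)).
  apply: (@leq_trans #|\bigcup_(v in N) [set f in F | v \in f]|).
    apply: subset_leq_card; apply/subsetP => f /cutP[u [v [uS vT fE fF]]].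
    apply/bigcupP; exists v; last by rewrite inE fF fE !inE eqxx orbT.
    by rewrite inE vT; apply/exists_inP; exists u; rewrite // /edge_rel /= -fE.
  elim/big_rec2: _ => [|v m X _ IH]; first by rewrite cards0.
  by rewrite (leq_trans (leq_card_setU _ _)) // leq_add2l.
apply: (@leq_trans (\sum_(v in N) (D + if D < degree F v then degree F v else 0))%N).
  by apply: leq_sum => v _; case: ltnP => h; rewrite ?leq_addl ?addn0.
rewrite big_split /= sum_nat_const mulnC leq_add2l.
by rewrite big_mkcond; apply: leq_sum => v _; case: ifP.
Qed.

End Pruning.

(** * Sizes of components near criticality *)

Section Numerics.
Variable R : realType.
Implicit Types (x e p : R) (m : nat).

(** Bonferroni inequalities for the probability that none of m independent
    events occurs. *)
Lemma expn1B_le x m : 0 <= x <= 1 ->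
  (1 - x) ^+ m <= 1 - m%:R * x + (m%:R * x) ^+ 2 / 2.
Proof.
move=> /andP[x0 x1]; elim: m => [|m IH]; first by rewrite expr0; lra.
rewrite [(1 - x) ^+ m.+1]exprS -natr1; have := @ler_wpM2l _ (1 - x) _ _ _ IH.
rewrite subr_ge0 => /(_ x1) h; apply: le_trans h _.
have m0 : 0 <= m%:R :> R by rewrite ler0n.
move: (m%:R) m0 => y y0.
have : 0 <= y ^+ 2 * x ^+ 3 / 2 + x ^+ 2 / 2.
  by rewrite addr_ge0 // ?divr_ge0 ?mulr_ge0 ?exprn_ge0.
by lra.
Qed.

Lemma expn1B_ge x m : 0 <= x <= 1 ->
  1 - m%:R * x + m%:R * (m%:R - 1) / 2 * x ^+ 2 - (m%:R * x) ^+ 3 / 6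
  <= (1 - x) ^+ m.
Proof.
move=> /andP[x0 x1]; elim: m => [|m IH]; first by rewrite expr0; lra.
rewrite [(1 - x) ^+ m.+1]exprS -natr1; have := @ler_wpM2l _ (1 - x) _ _ _ IH.
rewrite subr_ge0 => /(_ x1) h; apply: le_trans h.
have m0 : 0 <= m%:R :> R by rewrite ler0n.
move: (m%:R) m0 => y y0.
have : 0 <= y ^+ 3 * x ^+ 4 / 6 + (y + 1/6) * x ^+ 3.
  by rewrite addr_ge0 ?mulr_ge0 ?exprn_ge0 ?addr_ge0 ?mulr_ge0 ?exprn_ge0 //; lra.
by lra.
Qed.

Lemma bernoulli_ge x m : 0 <= x -> 1 + m%:R * x <= (1 + x) ^+ m.
Proof.
move=> x0; elim: m => [|m IH]; first by rewrite expr0; lra.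
rewrite exprS -natr1; have x1 : 0 <= 1 + x by lra.
have h := ler_wpM2l x1 IH; apply: le_trans h.
have m0 : 0 <= m%:R :> R by rewrite ler0n.
have : 0 <= m%:R * x ^+ 2 :> R by rewrite mulr_ge0 ?exprn_ge0.
by lra.
Qed.

(** The survival probability of a branching process of mean 1 + e is about 2 e.
    Here 1 - z^D plays its role, with z = 1 - a / D for an a slightly below
    2 e, which turns the fixed point equation for z into the inequality that the
    exploration needs. *)
Lemma prob_component_lt_le n (E : {set {set 'I_n}}) e p (K D : nat) (v : 'I_n) :
  0 < e -> e <= 1 / 100 -> 0 <= p <= 1 -> (0 < D)%N ->
  1 + 49 / 50 * e <= p * D%:R ->
  (forall A : {set 'I_n}, A != set0 -> (#|A| < K)%N ->
     (D * #|A| <= #|cut E A (~: A)|)%N) ->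
  prob p E (fun F => (#|reach F [set v]| < K)%N) <= 1 - 19 / 10 * e.
Proof.
move=> e0 e1 p01 D0 pD expE; have /andP[p0 p1] := p01.
have Dp : 0 < D%:R :> R by rewrite ltr0n.
have D1 : 1 <= D%:R :> R by rewrite ler1n.
(* a - a^2 / 2 must exceed 19/10 e, while (1 + 49/50 e) (1 - a / 2) >= 1 *)
pose a := 48 / 25 * e; pose z : R := 1 - a / D%:R.
have a0 : 0 <= a by rewrite mulr_ge0 // ltW.
have a1 : a <= 1 / 50 by rewrite /a; clear -e1; lra.
have a2 : 0 <= a - a ^+ 2 / 2 by clear -a0 a1; nra.
have a3 : a <= (1 + 49 / 50 * e) * (a - a ^+ 2 / 2).
  by rewrite /a; clear -e0 e1; nra.
have a4 : 19 / 10 * e <= a - a ^+ 2 / 2 by rewrite /a; clear -e0 e1; nra.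
have aD : a / D%:R * D%:R = a by rewrite divfK ?gt_eqF.
have ax0 : 0 <= a / D%:R by rewrite divr_ge0.
have ax1 : a / D%:R <= 1 / 50.
  by rewrite ler_pdivrMr //; apply: le_trans a1 _; rewrite ler_peMr.
have zD : z ^+ D <= 1 - a + a ^+ 2 / 2.
  have := @expn1B_le (a / D%:R) D; rewrite -/z [D%:R * _]mulrC aD; apply.
  by rewrite ax0; clear -ax1; lra.
have := @prob_reach_lt_le n R p z E K D [set v] p01; rewrite cards1 muln1 => h.
apply: le_trans (h _ _ expE _) _.
- by rewrite /z; clear -ax0 ax1; lra.
- have a5 : a / D%:R <= p * (a - a ^+ 2 / 2).
    rewrite ler_pdivrMr // mulrAC; apply: le_trans a3 _.
    by rewrite ler_wpM2r.
  have : p * z ^+ D <= p * (1 - a + a ^+ 2 / 2) by rewrite ler_wpM2l.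
  by move: (z ^+ D) => w; rewrite /z; clear -a5; lra.
- by apply/set0Pn; exists v; rewrite inE.
by apply: le_trans zD _; clear -a4; lra.
Qed.

(** Now z = 1 - 3 e / d lies beyond the fixed point: the factor th gained at
    each query has 1 - th of order e^2 / d, so that th^(d K) is negligible as
    soon as K is much larger than 1 / e^3. *)
Lemma prob_component_lt_ge n (E : {set {set 'I_n}}) e (K d : nat) (v : 'I_n) :
  0 < e -> e <= 1 / 100 -> (0 < d)%N -> d%:R^-1 <= 2 * e ^+ 4 ->
  e ^- 4 <= K%:R ->
  (forall v, (#|[set f in E | v \in f]| <= d)%N) ->
  1 - 31 / 10 * e <= prob ((1 + e) / d%:R) E
     (fun F : {set {set 'I_n}} => (#|reach F [set v]| < K)%N).
Proof.
move=> e0 e1 d0 di Ke degE.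
have dp : 0 < d%:R :> R by rewrite ltr0n.
have e2 : 0 < e ^+ 2 by rewrite exprn_gt0.
have e2s : e ^+ 2 <= e / 100 by clear -e0 e1; nra.
have e3s : e ^+ 3 <= e ^+ 2 / 100 by rewrite exprS; clear -e0 e1 e2; nra.
have e4s : e ^+ 4 <= e ^+ 2 / 100.
  by rewrite (_ : e ^+ 4 = e ^+ 2 * e ^+ 2); [clear -e0 e1 e2 e2s; nra | ring].
set p := (1 + e) / d%:R.
pose y : R := d%:R^-1.
have y0 : 0 < y by rewrite invr_gt0.
have ys : y <= 2 * e ^+ 4 by [].
have y1 : y <= 1 / 100 by clear -ys e4s e2s e1 e0; lra.
have pE : p = (1 + e) * y by [].
have p01 : 0 <= p <= 1 by rewrite pE; clear -y0 y1 e0 e1; nra.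
pose z : R := 1 - 3 * e * y; pose eta := e ^+ 2 / 2.
pose th : R := (1 + eta * y)^-1.
have eta0 : 0 < eta by rewrite divr_gt0.
have ey0 : 0 < eta * y by rewrite mulr_gt0.
have ey1 : 0 < e * y by rewrite mulr_gt0.
have ey2 : e * y <= 1 / 100 by clear -y0 y1 e0 e1; nra.
have dy : d%:R * y = 1 by rewrite /y mulfV ?gt_eqF.
have xb : 0 <= 3 * e * y <= 1 by clear -ey1 ey2; lra.
have z01 : 0 < z <= 1 by rewrite /z; clear -ey1 ey2; lra.
have zd : 1 - 3 * e + 18 / 5 * e ^+ 2 <= z ^+ d.
  apply: le_trans (expn1B_ge d xb).
  have -> : d%:R * (3 * e * y) = 3 * e * (d%:R * y) by ring.
  have -> : d%:R * (d%:R - 1) / 2 * (3 * e * y) ^+ 2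
    = 9 / 2 * e ^+ 2 * (d%:R * y) * (d%:R * y - y) by field.
  rewrite dy !mulr1.
  have : e ^+ 2 * y <= e ^+ 2 / 100 by clear -e2 y1; nra.
  by rewrite exprMn; clear -e3s e2; lra.
have t0 : 0 < 1 + eta * y by rewrite ltr_pwDl // ltW.
have th0 : 0 <= th by rewrite invr_ge0 ltW.
have th1 : th <= 1 by rewrite invf_le1 // lerDl ltW.
have hz : z <= th * (1 - p + p * z ^+ d).
  rewrite /th mulrC ler_pdivlMr // pE.
  have h1 : (1 + e) * y * (1 - 3 * e + 18 / 5 * e ^+ 2) <= (1 + e) * y * z ^+ d.
    by rewrite ler_wpM2l // -pE; case/andP: p01.
  have h2 : z * (1 + eta * y) <= 1 - (3 * e - eta) * y.
    have : 0 <= (e * y) * (eta * y) by rewrite mulr_ge0 ?ltW.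
    by rewrite /z; clear; lra.
  have : (1 + e) * (3 * e - 18 / 5 * e ^+ 2) <= 3 * e - eta.
    have : 0 < e ^+ 3 by rewrite exprn_gt0.
    by rewrite /eta; clear -e2; lra.
  move=> /(ler_wpM2l (ltW y0)) h3; apply: le_trans h2 _.
  by move: h1; move: (z ^+ d) => w; clear -h3; lra.
have := @prob_reach_lt_ge n R p z th E K d [set v] p01 z01; rewrite cards1 muln1 => h.
have {}h := h th0 th1 hz degE.
have Kp : 0 < K%:R :> R.
  by apply: lt_le_trans Ke; rewrite invr_gt0 exprn_gt0.
have tK : th ^+ (d * K) <= 2 * e ^+ 2.
  rewrite /th exprVn.
  have hb : 1 + eta * K%:R <= (1 + eta * y) ^+ (d * K).
    have -> : eta * K%:R = (d * K)%:R * (eta * y).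
      transitivity (eta * K%:R * (d%:R * y)); first by rewrite dy mulr1.
      by rewrite natrM; ring.
    by apply: bernoulli_ge; apply: ltW.
  have q : 1 <= 2 * e ^+ 2 * (1 + eta * K%:R).
    have e4K : 1 <= e ^+ 4 * K%:R.
      by rewrite mulrC -ler_pdivrMr ?exprn_gt0 // mul1r.
    have -> : 2 * e ^+ 2 * (1 + eta * K%:R) = 2 * e ^+ 2 + e ^+ 4 * K%:R.
      by rewrite /eta; field.
    by clear -e4K e2; lra.
  have B0 : 0 < (1 + eta * y) ^+ (d * K) by rewrite exprn_gt0.
  rewrite -[leLHS]mul1r ler_pdivrMr //; apply: le_trans q _.
  by rewrite ler_pM2l // mulr_gt0.
by move: h; rewrite -/(prob _ _ _); move: (prob _ _ _) => P h; clear -h zd tK e2s e2 e0; lra.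
Qed.

End Numerics.

(** * Exponential estimates *)

Section Bounds.
Variable R : realType.

Lemma expR_half_le2 : expR (2^-1) <= 2 :> R.
Proof.
have h : 2^-1 <= expR (- 2^-1) :> R.
  by apply: le_trans (expR_ge1Dx _); lra.
by rewrite -[leLHS]invrK -expRN -[leRHS]invrK lef_pV2 ?posrE ?invr_gt0 ?expR_gt0.
Qed.

Lemma le2_expR1 : 2 <= expR 1 :> R.
Proof. by apply: le_trans (expR_ge1Dx _); lra. Qed.

Lemma expRN_le_inv (y : R) : 0 < y -> expR (- y) <= y^-1.
Proof.
move=> y0; rewrite expRN lef_pV2 ?posrE ?expR_gt0 //.
by apply: le_trans (expR_ge1Dx _); lra.
Qed.

Lemma exp1D_le (y : R) m : 0 <= 1 + y -> (1 + y) ^+ m <= expR (m%:R * y).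
Proof.
move=> y0; rewrite expRM_natl; apply: lerXn2r; rewrite ?nnegrE ?expR_ge0 //.
exact: expR_ge1Dx.
Qed.

(** With T = ka e^3 n, the last factor is exp(-T), and the choice of s and of
    the threshold for e makes the other four at most exp(T / 5), exp(T / 10),
    exp(T / 20) and exp(T / 20). *)
Lemma union_bound_le (e L ka p1 p2 : R) (n K s N m : nat) :
  0 < e -> expR L = e^-1 -> 1 <= L -> 0 < ka -> e <= ka / 20 -> (0 < n)%N ->
  s%:R <= ka / 20 * e ^+ 3 * n%:R / L ->
  0 <= p1 -> p1 * m%:R <= 2 * n%:R -> e ^- 4 <= K%:R ->
  0 <= p2 <= 1 -> ka * e ^+ 3 * n%:R <= p2 / 2 * N%:R ->
  (e ^+ 4)^-1 ^+ s * (1 + p1 * e ^+ 4) ^+ m * 2 ^+ (n %/ K) * 2 ^+ s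
     * (1 - p2 / 2) ^+ N <= 2 / (ka * e ^+ 3 * n%:R).
Proof.
move=> e0 eL L1 ka0 eka n0 sL p10 p1m Ke p201 p2N.
have n0' : 0 < n%:R :> R by rewrite ltr0n.
have e3 : 0 < e ^+ 3 by rewrite exprn_gt0.
have e4 : 0 < e ^+ 4 by rewrite exprn_gt0.
have L0 : 0 < L by apply: lt_le_trans L1.
pose T := ka * e ^+ 3 * n%:R.
have T0 : 0 < T by rewrite !mulr_gt0.
have sT : L * s%:R <= T / 20.
  rewrite mulrC -ler_pdivlMr //; apply: le_trans sL _.
  by rewrite le_eqVlt; apply/orP; left; apply/eqP; rewrite /T; field; rewrite gt_eqF.
have e4T : e ^+ 4 * n%:R <= T / 20.
  have -> : e ^+ 4 * n%:R = e * (e ^+ 3 * n%:R) by ring.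
  have -> : T / 20 = ka / 20 * (e ^+ 3 * n%:R) by rewrite /T; ring.
  by rewrite ler_wpM2r // mulr_ge0 // ltW.
have f1 : (e ^+ 4)^-1 ^+ s <= expR (T / 20 * 4).
  have -> : (e ^+ 4)^-1 = expR (4 * L) by rewrite -exprVn -eL -expRM_natl.
  rewrite -expRM_natl ler_expR; clear -sT; lra.
have f2 : (1 + p1 * e ^+ 4) ^+ m <= expR (T / 20 * 2).
  apply: le_trans (exp1D_le _ _) _; first by rewrite addr_ge0 // mulr_ge0 // ltW.
  rewrite ler_expR; apply: (@le_trans _ _ (2 * (e ^+ 4 * n%:R))).
    have -> : m%:R * (p1 * e ^+ 4) = (p1 * m%:R) * e ^+ 4 by ring.
    have -> : 2 * (e ^+ 4 * n%:R) = (2 * n%:R) * e ^+ 4 by ring.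
    by rewrite ler_wpM2r // ltW.
  by clear -e4T; lra.
have two_le (k : nat) : 2 ^+ k <= expR k%:R :> R.
  by rewrite -[k%:R]mulr1 expRM_natl; apply: lerXn2r; rewrite ?nnegrE ?expR_ge0 ?le2_expR1.
have f3 : 2 ^+ (n %/ K) <= expR (T / 20) :> R.
  apply: le_trans (two_le _) _; rewrite ler_expR; apply: le_trans e4T.
  have K0 : 0 < K%:R :> R by apply: lt_le_trans Ke; rewrite invr_gt0.
  rewrite mulrC -ler_pdivrMr //.
  have : (n %/ K)%:R * K%:R <= n%:R :> R by rewrite -natrM ler_nat leq_trunc_div.
  apply: le_trans; rewrite ler_wpM2l //.
have f4 : 2 ^+ s <= expR (T / 20).
  apply: le_trans (two_le _) _; rewrite ler_expR; apply: le_trans sT.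
  by rewrite ler_peMl.
have f5 : (1 - p2 / 2) ^+ N <= expR (- T).
  apply: le_trans (exp1D_le _ _) _; first by clear -p201; lra.
  by rewrite ler_expR; move: p2N; rewrite -/T; clear; lra.
have P0 (k : nat) : 0 <= 2 ^+ k :> R by rewrite exprn_ge0.
have P1 : 0 <= (e ^+ 4)^-1 ^+ s by rewrite exprn_ge0 // invr_ge0 ltW.
have P2 : 0 <= (1 + p1 * e ^+ 4) ^+ m by rewrite exprn_ge0 // addr_ge0 // mulr_ge0 // ltW.
have P3 : 0 <= (1 - p2 / 2) ^+ N by rewrite exprn_ge0 //; clear -p201; lra.
apply: (@le_trans _ _ (expR (T / 20 * 4) * expR (T / 20 * 2) * expR (T / 20)
    * expR (T / 20) * expR (- T))).
  by do 4?[apply: ler_pM => //; rewrite ?mulr_ge0 //].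
rewrite -!expRD; apply: (@le_trans _ _ (expR (- (T / 2)))).
  by rewrite ler_expR; clear -T0; lra.
have -> : 2 / (ka * e ^+ 3 * n%:R) = (T / 2)^-1 by rewrite invf_div.
by apply: expRN_le_inv; rewrite divr_gt0.
Qed.
End Bounds.

(** * The core lies in the largest component *)

Section Deterministic.
Variables (R : realType) (n : nat).
Implicit Types S : {set 'I_n}.

(** F1 is the first round and F the union of both. The bound on the number of
    outer neighbours of a set of linear size is h e^3 n / L, the size of a cut
    that is not sparse, divided by the typical maximal degree 11 L; whence the
    square of the logarithm. *)
Lemma expander_in_giant (e L h : R) (K D s : nat) (F1 F : {set {set 'I_n}}) :
  0 < e -> 0 < h -> 0 < L -> F1 \subset F -> (0 < n)%N ->
  K%:R <= e * n%:R -> D%:R <= 11 * L ->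
  9 / 5 * e * n%:R <= #|big K F1|%:R ->
  #|big K F|%:R <= 16 / 5 * e * n%:R ->
  (heavy_degree D F)%:R <= h * e ^+ 3 * n%:R / L / 2 ->
  h * e ^+ 3 * n%:R / L <= s.+1%:R ->
  (forall S : {set 'I_n}, S \subset big K F1 ->
     e * n%:R / 100 <= #|S|%:R -> e * n%:R / 100 <= #|big K F1 :\: S|%:R ->
     (s < #|cut F S (big K F1 :\: S)|)%N) ->
  forall L1 : {set 'I_n}, largest_component (edge_rel F) L1 ->
  exists L1' : {set 'I_n},
    [/\ L1' \subset L1,
        7 * e * n%:R / 4 <= #|L1'|%:R
      & forall S : {set 'I_n}, S \subset L1' ->
          #|S|%:R <= #|L1'|%:R / 2 :> R ->
          h / 100 * e ^+ 2 * #|S|%:R / L ^+ 2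
            <= #|ext_nbhd (edge_rel F) L1' S|%:R].
Proof.
move=> e0 h0 L0 F1F n0 Ke DL W1 bigF heavyF sh cutF L1 L1max.
have n0' : 0 < n%:R :> R by rewrite ltr0n.
have en0 : 0 < e * n%:R by rewrite mulr_gt0.
pose W := big K F1; pose g := h / 100 * e ^+ 2 / L ^+ 2.
have g0 : 0 < g.
  by rewrite /g divr_gt0 ?exprn_gt0 // mulr_gt0 ?exprn_gt0 // divr_gt0.
have Wle : #|W|%:R <= 16 / 5 * e * n%:R.
  by apply: le_trans bigF; rewrite ler_nat subset_leq_card // big_sub.
have Wexp S : S \subset W -> e * n%:R / 100 <= #|S|%:R ->
    e * n%:R / 100 <= #|W :\: S|%:R -> g * #|S|%:R <= #|ext_nbhd (edge_rel F) W S|%:R.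
  move=> SW mS mWS; have := cutF S SW mS mWS.
  move/leq_trans/(_ (cut_le_nbhd F D SW)); rewrite -(ler_nat R) natrD natrM.
  move/(le_trans sh) => c.
  have SWc : #|S|%:R <= 16 / 5 * e * n%:R.
    by apply: le_trans Wle; rewrite ler_nat subset_leq_card.
  move: c; set N := (#|ext_nbhd _ _ _|%:R : R) => c.
  pose Y := h * e ^+ 3 * n%:R / L.
  have Y0 : 0 < Y by rewrite divr_gt0 // !mulr_gt0 // exprn_gt0.
  have N0 : 0 <= N by rewrite ler0n.
  have c1 : Y / 2 <= D%:R * N by move: c heavyF; rewrite -/Y; clear; lra.
  have c2 : Y / 2 <= 11 * L * N by apply: le_trans c1 _; rewrite ler_wpM2r.
  apply: (@le_trans _ _ (g * (16 / 5 * e * n%:R))); first by rewrite ler_wpM2l // ltW.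
  have -> : g * (16 / 5 * e * n%:R) = Y * (16 / 500) / L.
    by rewrite /g /Y; field; rewrite gt_eqF.
  rewrite ler_pdivrMr //; move: Y0 c2; rewrite [N * L]mulrC.
  by clear c c1; move: Y => y; rewrite -mulrA; move: (L * N) => z; clear; lra.
have [||W' [W'W W'c] W'exp] := @prune R n (edge_rel F) g (e * n%:R / 100) W g0 _ _ Wexp.
- by rewrite divr_gt0.
- by move: W1; rewrite -/W -mulrA; move: (e * n%:R) en0 => y; clear; lra.
have W'1 : 179 / 100 * (e * n%:R) <= #|W'|%:R.
  move: W'c W1; rewrite -/W -(mulrA _ e); move: (e * n%:R) => y; clear; lra.
have [W'0|[v vW']] := set_0Vmem W'.
  by move: W'1; rewrite W'0 cards0; move: (e * n%:R) en0 => y; clear; lra.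
exists W'; split.
- apply: (giant_contains (K := K) L1max (expands_connected g0 W'exp vW')).
    rewrite -(ler_nat R); apply: le_trans Ke (le_trans _ W'1).
    by move: (e * n%:R) en0 => y; clear; lra.
  rewrite -(ltr_nat R) natrD; apply: le_lt_trans bigF _.
  by rewrite -mulrA; move: (e * n%:R) en0 W'1 => y; clear; lra.
- apply: le_trans W'1; rewrite -(mulrA 7).
  by move: (e * n%:R) en0 => y; clear; lra.
move=> S SW' S2; apply: le_trans (W'exp S SW' S2).
by rewrite /g le_eqVlt; apply/orP; left; apply/eqP; rewrite mulrAC.
Qed.

End Deterministic.

(** * Probabilities in a fixed graph *)

Section Finite.
Variable R : realType.

Lemma percolation_prE n (G : rel 'I_n) (p : R) (Q : rel 'I_n -> Prop) :
  percolation_pr G p Q = prob p (edges G) (fun F => `[< Q (edge_rel F) >]).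
Proof.
rewrite /percolation_pr /prob /expect big_mkcondr; apply: eq_bigr => F _.
by case: `[< _ >]; rewrite ?mulr1 ?mulr0.
Qed.

Lemma prob_le1 (T : finType) p (U : {set T}) Q : 0 <= p <= 1 -> prob p U Q <= 1 :> R.
Proof.
move=> p01; rewrite -[leRHS](expect_cst p U); apply: le_expect => // F _.
by case: (Q F).
Qed.

(** The expected number of retained edges is O(n), so the variance is linear in n
    and deviations of order n have probability O(1 / n). *)
Lemma chebyshev_linear n (E : {set {set 'I_n}}) (p : R) (f : {set {set 'I_n}} -> R) (X t : R) :
  0 <= p <= 1 -> p * #|E|%:R <= 2 * n%:R -> 0 < t -> (0 < n)%N ->
  (forall (F : {set {set 'I_n}}) e, F \subset E -> e \in E -> `|f (e |: F) - f F| <= X) ->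
  prob p E (fun F => t * n%:R <= `|f F - expect p E f|) <= 2 * X ^+ 2 / t ^+ 2 / n%:R.
Proof.
move=> p01 pE t0 n0 fX; have n0' : 0 < n%:R :> R by rewrite ltr0n.
apply: le_trans (chebyshev_expect p01 (mulr_gt0 t0 n0') fX) _.
rewrite ler_pdivrMr ?exprn_gt0 ?mulr_gt0 //.
have -> : 2 * X ^+ 2 / t ^+ 2 / n%:R * (t * n%:R) ^+ 2 = (2 * n%:R) * X ^+ 2.
  by field; rewrite !gt_eqF.
by rewrite ler_wpM2r ?sqr_ge0.
Qed.

Section Graph.
Variables (n d : nat) (lambda e : R) (G : rel 'I_n).
Hypothesis ndlG : ndl_graph d lambda G.
Hypothesis d_gt0 : (0 < d)%N.
Hypothesis e_gt0 : 0 < e.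
Hypothesis e_small : e <= 1 / 100.
Hypothesis n_large : 2 <= e ^+ 8 * n%:R.
Hypothesis lambda_small : lambda <= e ^+ 4 * d%:R.
Local Notation E := (edges G).

Lemma powers_of_e : [/\ 0 < e ^+ 2, e ^+ 2 <= e / 100, 0 < e ^+ 4,
   e ^+ 4 <= e ^+ 2 / 100 & e ^+ 4 <= e / 100].
Proof.
have e2 : 0 < e ^+ 2 by rewrite exprn_gt0.
have e4 : 0 < e ^+ 4 by rewrite exprn_gt0.
have e2s : e ^+ 2 <= e / 100.
  by rewrite expr2 ler_pM2l //; move: e_small; lra.
have e4s : e ^+ 4 <= e ^+ 2 / 100.
  rewrite (_ : e ^+ 4 = e ^+ 2 * e ^+ 2); last by ring.
  by rewrite ler_pM2l //; move: e_small e2s; lra.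
by split => //; move: e4s e2s e_gt0; lra.
Qed.

Let d_gt0' : 0 < d%:R :> R. Proof. by rewrite ltr0n. Qed.

Lemma expn_itv k : 0 <= e ^+ k <= 1.
Proof.
by rewrite exprn_ge0 ?exprn_ile1 // ltW //; move: e_small; lra.
Qed.

Lemma order_gt1 : (1 < n)%N.
Proof.
rewrite -(ler_nat R); apply: le_trans n_large _.
by rewrite ler_piMl ?ler0n //; case/andP: (expn_itv 8).
Qed.

Let n_gt0 : 0 < n%:R :> R. Proof. by rewrite ltr0n ltnW ?order_gt1. Qed.

Lemma lambda_lt : lambda < d%:R.
Proof.
apply: le_lt_trans lambda_small _; rewrite gtr_pMl //.
by have [_ _ _ _] := powers_of_e; move: e_small; lra.
Qed.

(** A lower bound for the degree, as required for degrees to behave like those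
    of a branching process with Poisson offspring. *)
Lemma inv_degree : d%:R^-1 <= 2 * e ^+ 4.
Proof.
have h := degree_lower ndlG order_gt1 lambda_lt d_gt0.
have [_ _ e4 _ _] := powers_of_e.
have /andP[_ e41] := expn_itv 4.
have h2 : 2 / n%:R <= e ^+ 4.
  rewrite ler_pdivrMr //; apply: le_trans n_large _; rewrite ler_pM2r //.
  have -> : e ^+ 8 = e ^+ 4 * e ^+ 4 by ring.
  by rewrite ler_piMl // ltW.
rewrite -[leLHS]mul1r ler_pdivrMr //; apply: le_trans h _.
have : 2 * d%:R / n%:R <= e ^+ 4 * d%:R by rewrite mulrAC ler_pM2r.
by move: lambda_small; lra.
Qed.

(** A set of fewer than K vertices has almost all of its edges in its boundary,
    so that its exploration dominates a branching process with almost d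
    potential children per vertex. *)
Lemma boundary_small K (A : {set 'I_n}) : K%:R <= e ^+ 4 * n%:R :> R ->
  A != set0 -> (#|A| < K)%N ->
  (Num.truncn ((1 - 2 * e ^+ 4) * d%:R) * #|A| <= #|cut E A (~: A)|)%N.
Proof.
move=> Kn A0 AK; rewrite -(ler_nat R) natrM.
apply: le_trans (boundary_ge ndlG order_gt1 lambda_lt A).
have [e2 e2s e4 e4s e4s'] := powers_of_e.
have x0 : 0 <= (1 - 2 * e ^+ 4) * d%:R.
  by rewrite mulr_ge0 ?ltW //; move: e4s' e_small; lra.
have /andP[tx _] := truncn_itv x0.
have a0 : 0 < #|A|%:R :> R by rewrite ltr0n card_gt0.
apply: (@le_trans _ _ ((1 - 2 * e ^+ 4) * d%:R * #|A|%:R)); first by rewrite ler_wpM2r // ltW.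
have aK : #|A|%:R <= e ^+ 4 * n%:R.
  by apply: le_trans Kn; rewrite ler_nat ltnW.
have h1 : d%:R * #|A|%:R ^+ 2 / n%:R <= d%:R * #|A|%:R * e ^+ 4.
  rewrite ler_pdivrMr // expr2 mulrA -[leRHS]mulrA ler_pM2l //.
  by rewrite mulr_gt0.
have h2 : lambda * #|A|%:R <= e ^+ 4 * d%:R * #|A|%:R by rewrite ler_pM2r.
by move: h1 h2; lra.
Qed.

Lemma expected_big_ge K p1 : p1 = (1 + 99 / 100 * e) / d%:R -> 0 <= p1 <= 1 ->
  K%:R <= e ^+ 4 * n%:R :> R ->
  19 / 10 * e * n%:R <= expect p1 E (fun F => #|big K F|%:R).
Proof.
move=> p1E p1_01 Kn; rewrite expect_big.
have -> : 19 / 10 * e * n%:R = \sum_(v : 'I_n) (19 / 10 * e).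
  by rewrite sumr_const card_ord mulr_natr.
apply: ler_sum => v _; rewrite lerBrDr -lerBrDl.
have [e2 e2s e4 e4s e4s'] := powers_of_e.
have x0 : 0 <= (1 - 2 * e ^+ 4) * d%:R.
  by rewrite mulr_ge0 ?ltW //; move: e4s' e_small; lra.
have /andP[_ tx] := truncn_itv x0.
have tx' : (1 - 4 * e ^+ 4) * d%:R <= (Num.truncn ((1 - 2 * e ^+ 4) * d%:R))%:R.
  have : 1 <= 2 * e ^+ 4 * d%:R.
    by rewrite -ler_pdivrMr // mul1r; exact: inv_degree.
  by move: tx; rewrite -natr1; lra.
apply: (prob_component_lt_le (D := Num.truncn ((1 - 2 * e ^+ 4) * d%:R))) => //.
- rewrite -(ltr_nat R); apply: lt_le_trans tx'; rewrite mulr_gt0 //.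
  by move: e4s' e_small; lra.
- have /andP[p10 _] := p1_01.
  apply: le_trans (ler_wpM2l p10 tx'); rewrite p1E.
  have -> : (1 + 99 / 100 * e) / d%:R * ((1 - 4 * e ^+ 4) * d%:R)
    = (1 + 99 / 100 * e) * (1 - 4 * e ^+ 4) by field; rewrite gt_eqF.
  have : e * e ^+ 4 <= e ^+ 4 by rewrite ler_piMl ?ltW //; move: e_small; lra.
  by move: e2 e2s e4s e4s' e_small e_gt0; lra.
by move=> A; apply: boundary_small.
Qed.

Lemma expected_big_le K p : p = (1 + e) / d%:R -> 0 <= p <= 1 -> e ^- 4 <= K%:R ->
  expect p E (fun F => #|big K F|%:R) <= 31 / 10 * e * n%:R.
Proof.
move=> -> p01 Ke; rewrite expect_big.
have -> : 31 / 10 * e * n%:R = \sum_(v : 'I_n) (31 / 10 * e).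
  by rewrite sumr_const card_ord mulr_natr.
apply: ler_sum => v _; rewrite lerBlDr -lerBlDl.
apply: prob_component_lt_ge => //; first exact: inv_degree.
by move=> w; apply: (degree_edges ndlG).
Qed.

Lemma cut_lower (S T : {set 'I_n}) : [disjoint S & T] ->
  e * n%:R / 100 <= #|S|%:R :> R -> e * n%:R / 100 <= #|T|%:R :> R ->
  (Num.truncn (d%:R * n%:R * (1 / 100) ^+ 2 * e ^+ 2 / 2) <= #|cut E S T|)%N.
Proof.
move=> dST mS mT.
have [e2 e2s e4 e4s e4s'] := powers_of_e.
have x0 : 0 <= d%:R * n%:R * (1 / 100) ^+ 2 * e ^+ 2 / 2.
  by rewrite divr_ge0 ?mulr_ge0 ?exprn_ge0 ?ltW.
have /andP[tx _] := truncn_itv x0.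
rewrite -(ler_nat R); apply: le_trans tx _.
apply: le_trans (mixing ndlG order_gt1 lambda_lt dST).
have STn : #|S|%:R + #|T|%:R <= n%:R :> R.
  rewrite -natrD ler_nat -[leqRHS](card_ord n) -cardsUI.
  by rewrite (eqP (_ : S :&: T == set0)) ?setI_eq0 // cards0 addn0 max_card.
have m0 : 0 < e * n%:R / 100 by rewrite divr_gt0 ?mulr_gt0.
have ST : (e * n%:R / 100) * (e * n%:R / 100) <= #|S|%:R * #|T|%:R.
  by apply: ler_pM => //; apply: ltW.
have h1 : d%:R * n%:R * (1 / 100) ^+ 2 * e ^+ 2 <= d%:R * #|S|%:R * #|T|%:R / n%:R.
  rewrite ler_pdivlMr // -[leRHS]mulrA.
  have -> : d%:R * n%:R * (1 / 100) ^+ 2 * e ^+ 2 * n%:R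
     = d%:R * ((e * n%:R / 100) * (e * n%:R / 100)) by field.
  by rewrite ler_pM2l.
have h2 : lambda * (#|S|%:R + #|T|%:R) <= e ^+ 4 * d%:R * n%:R.
  apply: (@le_trans _ _ (e ^+ 4 * d%:R * (#|S|%:R + #|T|%:R))).
    by rewrite ler_wpM2r // addr_ge0.
  by rewrite ler_pM2l // mulr_gt0.
have h3 : e ^+ 4 * d%:R * n%:R <= d%:R * n%:R * (1 / 100) ^+ 2 * e ^+ 2.
  have h4 : e ^+ 4 <= (1 / 100) ^+ 2 * e ^+ 2.
    have -> : e ^+ 4 = e ^+ 2 * e ^+ 2 by ring.
    have c0 : 0 <= 1 / 100 :> R by rewrite divr_ge0.
    have e0 := ltW e_gt0.
    by rewrite ler_pM2r //; apply: lerXn2r.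
  have -> : e ^+ 4 * d%:R * n%:R = d%:R * n%:R * (e ^+ 4) by ring.
  by rewrite -[leRHS]mulrA ler_pM2l // mulr_gt0.
by move: h1 h2 h3; lra.
Qed.

End Graph.
End Finite.

(** * The theorem *)

Section Main.
Variable R : realType.

Definition has_expanding_core (c e : R) n (Gp : rel 'I_n) :=
  forall L1 : {set 'I_n}, largest_component Gp L1 ->
  exists L1' : {set 'I_n},
    [/\ L1' \subset L1,
        7 * e * n%:R / 4 <= #|L1'|%:R
      & forall S : {set 'I_n}, S \subset L1' ->
          #|S|%:R <= #|L1'|%:R / 2 :> R ->
          c * e ^+ 2 * #|S|%:R / (ln (1 / e)) ^+ 2
            <= #|ext_nbhd Gp L1' S|%:R].

(** The first round has edge probability (1 + 99/100 e) / d; the second one, of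
    edge probability at least e / (100 d), is what remains of (1 + e) / d. The
    four error terms are two applications of Chebyshev to the number of
    vertices in large components, for the first round and for the union, one
    to the heavy degrees, and the union bound over sparse cuts. *)
Lemma percolation_pr_core_ge (ka h e : R) : 
  ka = (1 / 100) ^+ 3 / 8 -> h = ka / 20 ->
  0 < e -> e <= 1 / 100 -> e <= ka / 20 -> e <= expR (- 1) ->
  e * (4 * (expR 6 + 1)) <= h ->
  exists C : R, forall n d (lambda : R) (G : rel 'I_n),
    2 <= e ^+ 8 * n%:R -> ndl_graph d lambda G -> (0 < d)%N ->
    lambda <= e ^+ 4 * d%:R ->
    1 - C / n%:R <=
      percolation_pr G ((1 + e) / d%:R) (has_expanding_core (h / 100) e (n := n))
      <= 1.
Proof.
move=> kaE hE e0 e100 eka eexp eh.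
have [e2 e2s e4 e4s e4s'] := powers_of_e e0 e100.
have e3 : 0 < e ^+ 3 by rewrite exprn_gt0.
have e5 : 0 < e ^+ 5 by rewrite exprn_gt0.
have ka0 : 0 < ka by rewrite kaE divr_gt0 // exprn_gt0.
have h0 : 0 < h by rewrite hE divr_gt0.
pose L := ln (1 / e).
have eL : expR L = e^-1 by rewrite /L lnK ?posrE ?div1r // invr_gt0.
have L1 : 1 <= L.
  by rewrite -ler_expR eL -[leLHS]invrK -expRN lef_pV2 ?posrE ?expR_gt0.
have L0 : 0 < L by apply: lt_le_trans L1.
have eL1 : e * L <= 1.
  have hL := expR_ge1Dx L; rewrite eL in hL.
  rewrite -(mulfV (_ : e != 0)) ?gt_eqF // ler_pM2l //.
  by clear -hL; lra.
(* K is much larger than e^(-3), and there are at most e^4 n components with K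
   vertices, which leaves their 2^(e^4 n) unions negligible. *)
pose K := (Num.truncn (e ^- 4)).+1.
(* 2^(-D) <= e^5, which makes the expected heavy degree O(e^5 n) *)
pose D := (Num.truncn (10 * L)).+1.
have iv4 : 0 <= e ^- 4 by rewrite invr_ge0 ltW.
have Ke : e ^- 4 <= K%:R by apply: ltW; case/andP: (truncn_itv iv4).
have Ke' : K%:R <= e ^- 4 + 1.
  by rewrite /K -natr1 lerD2r; case/andP: (truncn_itv iv4).
have L10 : 0 <= 10 * L by clear -L0; lra.
have DL : 10 * L <= D%:R by apply: ltW; case/andP: (truncn_itv L10).
have DL' : D%:R <= 11 * L.
  have : D%:R <= 10 * L + 1.
    by rewrite /D -natr1 lerD2r; case/andP: (truncn_itv L10).
  by clear -L1; lra.
(* Chebyshev bounds with deviations e n / 10 and e^5 n *)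
pose C1 : R := 2 * (2 * K)%:R ^+ 2 / (e / 10) ^+ 2.
pose C2 : R := 2 * (2 * D.+1)%:R ^+ 2 / (e ^+ 5) ^+ 2.
exists (C1 + C1 + C2 + 2 / (ka * e ^+ 3)) => n d lambda G n_large ndlG d0 lsmall.
have n1 := order_gt1 e0 e100 n_large.
have n0 : (0 < n)%N by apply: ltnW.
have n0' : 0 < n%:R :> R by rewrite ltr0n.
have d0' : 0 < d%:R :> R by rewrite ltr0n.
have dV := inv_degree ndlG d0 e0 e100 n_large lsmall.
have dV0 : 0 < d%:R^-1 :> R by rewrite invr_gt0.
pose p : R := (1 + e) / d%:R.
pose p1 : R := (1 + 99 / 100 * e) / d%:R.
pose p2 : R := (p - p1) / (1 - p1).
pose E := edges G.
have p_le : p <= 1 / 2.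
  have : (1 + e) * d%:R^-1 <= 2 * d%:R^-1 by rewrite ler_pM2r //; clear -e100; lra.
  by rewrite /p; clear -dV e4s' e100; lra.
have p1_p : p - p1 = e / 100 / d%:R by rewrite /p /p1; field; rewrite gt_eqF.
have pp1 : 0 < p - p1 by rewrite p1_p !divr_gt0.
have p10 : 0 <= p1 by rewrite /p1 divr_ge0 // ltW //; clear -e0; lra.
have p01 : 0 <= p <= 1 by clear -p_le p10 pp1; lra.
have p101 : 0 <= p1 <= 1 by clear -p_le p10 pp1; lra.
have q0 : 0 < 1 - p1 by clear -p_le p10 pp1; lra.
have p2ge : e / 100 / d%:R <= p2.
  by rewrite /p2 -p1_p ler_pdivlMr // ler_piMr ?(ltW pp1) //; clear -p10; lra.
have p201 : 0 <= p2 <= 1.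
  rewrite /p2; apply/andP; split; first by apply: divr_ge0; apply: ltW.
  by rewrite ler_pdivrMr // mul1r; clear -p_le; lra.
have pE : 1 - p = (1 - p1) * (1 - p2) by rewrite /p2; field; rewrite gt_eqF.
have edges_le (r : R) : 0 <= r -> r <= 2 -> r / d%:R * #|E|%:R <= 2 * n%:R.
  move=> r0 r2; apply: (@le_trans _ _ (r / d%:R * (n%:R * d%:R))).
    rewrite ler_wpM2l ?divr_ge0 // -natrM ler_nat.
    exact: card_edges ndlG.
  have -> : r / d%:R * (n%:R * d%:R) = r * n%:R by field; rewrite gt_eqF.
  by rewrite ler_pM2r.
have pEn : p * #|E|%:R <= 2 * n%:R.
  by apply: edges_le; clear -e0 e100; lra.
have p1En : p1 * #|E|%:R <= 2 * n%:R.
  by apply: edges_le; clear -e0 e100; lra.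
have Kn : K%:R <= e ^+ 4 * n%:R.
  apply: le_trans Ke' _; rewrite -(ler_pM2l e4) mulrDr mulr1 divff ?gt_eqF //.
  apply: (@le_trans _ _ 2); first by clear -e4s' e100; lra.
  by apply: le_trans n_large _; rewrite mulrA -exprD.
have Ken : K%:R <= e * n%:R.
  by apply: le_trans Kn _; rewrite ler_pM2r //; clear -e4s' e0; lra.
pose Eb1 := expect p1 E (fun F => #|big K F|%:R : R).
pose Eb := expect p E (fun F => #|big K F|%:R : R).
pose Eh := expect p E (fun F => (heavy_degree D F)%:R : R).
have Eb1_ge : 19 / 10 * e * n%:R <= Eb1.
  exact: (expected_big_ge ndlG d0 e0 e100 n_large lsmall (erefl p1) p101 Kn).
have Eb_le : Eb <= 31 / 10 * e * n%:R.
  exact: (expected_big_le ndlG d0 e0 e100 n_large lsmall (erefl p) p01 Ke).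
have Eh_le : Eh <= n%:R * (expR 6 * e ^+ 5).
  apply: le_trans (expect_heavy D p01 (degree_edges ndlG)) _.
  rewrite -mulrA ler_pM2l //.
  have t1 : (1 + 3 * p) ^+ d <= expR 6.
    apply: le_trans (exp1D_le _ _) _; first by case/andP: p01; clear; lra.
    rewrite ler_expR (_ : d%:R * (3 * p) = 3 * (1 + e)).
      by clear -e100; lra.
    by rewrite /p; field; rewrite gt_eqF.
  have t2 : 2 ^- D <= e ^+ 5.
    rewrite -[leRHS]invrK lef_pV2 ?posrE ?invr_gt0 ?exprn_gt0 //.
    rewrite -exprVn -eL -expRM_natl; apply: (@le_trans _ _ (expR (2^-1) ^+ D)).
      by rewrite -expRM_natl ler_expR; clear -DL; lra.
    by apply: lerXn2r; rewrite ?nnegrE ?expR_ge0 ?expR_half_le2.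
  have p3 : 0 <= 1 + 3 * p by case/andP: p01; clear; lra.
  by apply: ler_pM; rewrite ?invr_ge0 ?exprn_ge0.
pose s := Num.truncn (h * e ^+ 3 * n%:R / L).
have hs0 : 0 <= h * e ^+ 3 * n%:R / L by rewrite ltW // divr_gt0 // !mulr_gt0.
have s_le : s%:R <= h * e ^+ 3 * n%:R / L by case/andP: (truncn_itv hs0).
have s_gt : h * e ^+ 3 * n%:R / L <= s.+1%:R by apply: ltW; case/andP: (truncn_itv hs0).
pose N := Num.truncn (d%:R * n%:R * (1 / 100) ^+ 2 * e ^+ 2 / 2 : R).
have p2N : ka * e ^+ 3 * n%:R <= p2 / 2 * N%:R.
  have y0 : 0 <= d%:R * n%:R * (1 / 100) ^+ 2 * e ^+ 2 / 2 :> R.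
    by rewrite !mulr_ge0 ?exprn_ge0 ?divr_ge0 ?invr_ge0 ?ltW.
  have y2 : 2 <= d%:R * n%:R * (1 / 100) ^+ 2 * e ^+ 2 / 2 :> R.
    have f1 : 4 <= e ^+ 4 * n%:R.
      have : 2 / e ^+ 4 <= e ^+ 4 * n%:R.
        by rewrite ler_pdivrMr // mulrAC -exprD.
      apply: le_trans; rewrite ler_pdivlMr //; clear -e4s' e100; lra.
    have f2 : e ^+ 2 <= (1 / 100) ^+ 2 by apply: lerXn2r; rewrite ?nnegrE // ltW.
    have f3 : e ^+ 4 * n%:R <= d%:R * n%:R * (1 / 100) ^+ 2 * e ^+ 2.
      have -> : e ^+ 4 * n%:R = 1 * n%:R * e ^+ 2 * e ^+ 2 by ring.
      have dge1 : 1 <= d%:R :> R by rewrite ler1n.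
      rewrite ler_pM2r //; apply: ler_pM; rewrite ?(ltW e2) //.
      by rewrite mul1r ler_peMl // ltW.
    rewrite ler_pdivlMr //; apply: le_trans _ f3.
    by clear -f1; lra.
  have /andP[_ Nge] := truncn_itv y0.
  have Nge' : d%:R * n%:R * (1 / 100) ^+ 2 * e ^+ 2 / 4 <= N%:R :> R.
    by move: Nge y2; rewrite -/N -natr1; clear; lra.
  apply: (@le_trans _ _ (e / 100 / d%:R / 2 * (d%:R * n%:R * (1 / 100) ^+ 2 * e ^+ 2 / 4))).
    by rewrite le_eqVlt; apply/orP; left; apply/eqP; rewrite kaE; field; rewrite gt_eqF.
  apply: ler_pM => //.
  - by rewrite !divr_ge0 // ltW.
  - by rewrite !mulr_ge0 ?exprn_ge0 ?divr_ge0 ?invr_ge0 ?ltW.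
  by rewrite ler_pM2r.
pose b1 (F1 : {set {set 'I_n}}) := e / 10 * n%:R <= `|#|big K F1|%:R - Eb1|.
pose b2 (F : {set {set 'I_n}}) := e / 10 * n%:R <= `|#|big K F|%:R - Eb|.
pose b3 (F : {set {set 'I_n}}) := e ^+ 5 * n%:R <= `|(heavy_degree D F)%:R - Eh|.
have edge_pair f : f \in E -> exists u v, f = [set u; v].
  by move=> /edgesP[u [v [-> _]]]; exists u, v.
have b1_le : prob p1 E b1 <= C1 / n%:R.
  apply: chebyshev_linear => //; first by rewrite divr_gt0.
  by move=> F f _ /edge_pair[u [v ->]]; apply: big_flip.
have b2_le : prob p E b2 <= C1 / n%:R.
  apply: chebyshev_linear => //; first by rewrite divr_gt0.
  by move=> F f _ /edge_pair[u [v ->]]; apply: big_flip.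
have b3_le : prob p E b3 <= C2 / n%:R.
  apply: chebyshev_linear => //.
  by move=> F f _ /edge_pair[u [v ->]]; apply: heavy_flip; rewrite cards2; case: eqP.
pose sp : {set {set 'I_n}} -> {set {set 'I_n}} -> bool := sparse_cut K (e * n%:R / 100) s.
have sp_le : expect p1 E (fun F1 => prob p2 E (fun F2 => sp F1 F2))
    <= 2 / (ka * e ^+ 3) / n%:R.
  have x01 : 0 < e ^+ 4 <= 1 by rewrite e4 /=; clear -e4s' e100; lra.
  apply: le_trans (sparse_cut_prob (N := N) _ _ x01 p101 p201 _) _ => //.
    by move=> S T; apply: (cut_lower ndlG d0 e0 e100 n_large lsmall).
  have -> : 2 / (ka * e ^+ 3) / n%:R = 2 / (ka * e ^+ 3 * n%:R).
    by rewrite -mulrA -invfM.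
  by apply: (union_bound_le e0 eL L1) => //; rewrite -hE.
rewrite percolation_prE -/E -/p; set Qb := fun F => _.
apply/andP; split; last exact: prob_le1.
(* Either one of the four bad events occurs or the core exists. *)
have main (F1 F2 : {set {set 'I_n}}) : F1 \subset E -> F2 \subset E ->
    1 <= ((Qb (F1 :|: F2))%:R + (b2 (F1 :|: F2))%:R + (b3 (F1 :|: F2))%:R)
         + (b1 F1)%:R + (sp F1 F2)%:R :> R.
  move=> F1E F2E.
  have nn (b : bool) : 0 <= b%:R :> R by rewrite ler0n.
  have := nn (Qb (F1 :|: F2)); have := nn (b2 (F1 :|: F2)).
  have := nn (b3 (F1 :|: F2)); have := nn (b1 F1); have := nn (sp F1 F2).
  case: (boolP (b1 F1)) => [_|nb1]; first by rewrite /=; clear; lra.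
  case: (boolP (b2 _)) => [_|nb2]; first by rewrite /=; clear; lra.
  case: (boolP (b3 _)) => [_|nb3]; first by rewrite /=; clear; lra.
  case: (boolP (sp _ _)) => [_|nsp]; first by rewrite /=; clear; lra.
  suff -> : Qb (F1 :|: F2) = true by rewrite /=; clear; lra.
  apply/asboolP; apply: (@expander_in_giant R n e L h K D s F1) => //.
  - exact: subsetUl.
  - move: nb1; rewrite /b1 -ltNge ltr_norml => /andP[+ _].
    by move: Eb1_ge; clear; lra.
  - move: nb2; rewrite /b2 -ltNge ltr_norml => /andP[_].
    by move: Eb_le; clear; lra.
  - move: nb3; rewrite /b3 -ltNge ltr_norml => /andP[_ hb].
    have : (heavy_degree D (F1 :|: F2))%:R <= n%:R * e ^+ 5 * (expR 6 + 1).
      by move: hb Eh_le; clear; lra.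
    move/le_trans; apply; rewrite ler_pdivlMr // ler_pdivlMr //.
    have -> : n%:R * e ^+ 5 * (expR 6 + 1) * 2 * L
      = (e ^+ 3 * n%:R) * (e * (2 * (expR 6 + 1)) * (e * L)) by ring.
    have -> : h * e ^+ 3 * n%:R = (e ^+ 3 * n%:R) * h by ring.
    rewrite ler_pM2l ?mulr_gt0 //.
    have c0 : 0 <= e * (2 * (expR 6 + 1)) by rewrite !mulr_ge0 ?ltW // addr_gt0 ?expR_gt0.
    apply: le_trans (_ : _ <= e * (2 * (expR 6 + 1))) _; first by rewrite ler_piMr.
    by move: eh c0; clear; lra.
  - move=> S SW mS mWS; rewrite ltnNge; apply: contra nsp => cS.
    by apply/existsP; exists S; apply/and4P.
have int1 : 1 <= expect p1 E (fun F1 => expect p2 E (fun F2 =>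
   ((Qb (F1 :|: F2))%:R + (b2 (F1 :|: F2))%:R + (b3 (F1 :|: F2))%:R)
         + (b1 F1)%:R + (sp F1 F2)%:R)).
  rewrite -{1}(expect_cst p1 E 1); apply: le_expect => // F1 F1E.
  by rewrite -{1}(expect_cst p2 E 1); apply: le_expect => // F2; apply: main.
have int2 : expect p1 E (fun F1 => expect p2 E (fun F2 =>
   ((Qb (F1 :|: F2))%:R + (b2 (F1 :|: F2))%:R + (b3 (F1 :|: F2))%:R)
         + (b1 F1)%:R + (sp F1 F2)%:R))
  = prob p E Qb + prob p E b2 + prob p E b3 + prob p1 E b1
    + expect p1 E (fun F1 => prob p2 E (fun F2 => sp F1 F2)).
  rewrite /prob -!expectD (expect_union _ _ pE) -!expectD.
  by apply: eq_expect => F1 _; rewrite !expectD expect_cst.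
move: int1; rewrite int2.
have -> : (C1 + C1 + C2 + 2 / (ka * e ^+ 3)) / n%:R
  = C1 / n%:R + C1 / n%:R + C2 / n%:R + 2 / (ka * e ^+ 3) / n%:R by rewrite !mulrDl.
by move: b1_le b2_le b3_le sp_le; clear; lra.
Qed.
End Main.

Local Open Scope classical_set_scope.
Local Open Scope ring_scope.

Theorem theorem3 (R : realType) :
  exists c eps0 : R, [/\ 0 < c, 0 < eps0 &
  forall eps delta : R, 0 < eps -> eps <= eps0 -> 0 < delta ->
  delta <= eps ^+ 4 ->
  forall (n d : nat -> nat) (lambda : nat -> R) (G : forall k, rel 'I_(n k)),
  n k @[k --> \oo] --> \oo ->
  (forall k, ndl_graph (d k) (lambda k) (G k)) ->
  (forall k, (0 < d k)%N) ->
  (forall k, lambda k / (d k)%:R <= delta) ->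
  percolation_pr (G k) ((1 + eps) / (d k)%:R)
    (fun Gp : rel 'I_(n k) =>
      forall L1 : {set 'I_(n k)}, largest_component Gp L1 ->
      exists L1' : {set 'I_(n k)},
        [/\ L1' \subset L1,
            7 * eps * (n k)%:R / 4 <= #|L1'|%:R
          & forall S : {set 'I_(n k)}, S \subset L1' ->
              #|S|%:R <= #|L1'|%:R / 2 :> R ->
              c * eps ^+ 2 * #|S|%:R / (ln (1 / eps)) ^+ 2
                <= #|ext_nbhd Gp L1' S|%:R])
    @[k --> \oo] --> (1 : R)].
Proof.
pose ka : R := (1 / 100) ^+ 3 / 8; pose h := ka / 20.
have ka0 : 0 < ka by rewrite divr_gt0 ?exprn_gt0 ?divr_gt0.
have h0 : 0 < h by rewrite divr_gt0.
have E6 : 0 < 4 * (expR 6 + 1) :> R by rewrite mulr_gt0 // addr_gt0 // expR_gt0.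
exists (h / 100), (Num.min (Num.min (1 / 100) (ka / 20))
                 (Num.min (expR (- 1)) (h / (4 * (expR 6 + 1))))).
split; first by rewrite divr_gt0.
  by rewrite !lt_min !divr_gt0 // expR_gt0.
move=> e delta e0; rewrite !le_min => /andP[/andP[e100 eka] /andP[eexp eh]].
move=> delta0 deltae n d lambda G n_oo ndlG d0 lambda_le.
have {}eh : e * (4 * (expR 6 + 1)) <= h by rewrite -ler_pdivlMr.
have [C HC] := percolation_pr_core_ge (erefl ka) (erefl h) e0 e100 eka eexp eh.
apply/cvgrPdist_le => t t0.
(* n >= |C| / t makes the error at most t *)
pose M := (Num.truncn (`|C| / t + 2 / e ^+ 8)).+1.
have /cvgnyPge/(_ M) := n_oo.
apply: filterS => k nM.
have e8 : 0 < e ^+ 8 by rewrite exprn_gt0.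
have x0 : 0 <= `|C| / t + 2 / e ^+ 8.
  by rewrite addr_ge0 // divr_ge0 // ltW.
have nk : `|C| / t + 2 / e ^+ 8 <= (n k)%:R.
  by apply: ltW (lt_le_trans _ (_ : M%:R <= _)); rewrite ?ler_nat //;
    case/andP: (truncn_itv x0).
have a0 : 0 <= `|C| / t by rewrite divr_ge0 // ltW.
have b0 : 0 <= 2 / e ^+ 8 by rewrite divr_ge0 // ltW.
have n2 : 2 <= e ^+ 8 * (n k)%:R.
  by rewrite mulrC -ler_pdivrMr //; apply: le_trans nk; rewrite lerDr.
have dk0 : 0 < (d k)%:R :> R by rewrite ltr0n.
have lk : lambda k <= e ^+ 4 * (d k)%:R.
  by rewrite -ler_pdivrMr //; apply: le_trans deltae.
have /andP[] := HC _ _ _ (G k) n2 (ndlG k) (d0 k) lk.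
rewrite /has_expanding_core; set u := percolation_pr _ _ _ => u1 u2.
rewrite ger0_norm ?subr_ge0 //.
have n0 : 0 < (n k)%:R :> R.
  apply: lt_le_trans nk; apply: ltr_wpDl => //; exact: divr_gt0.
have : C / (n k)%:R <= t.
  rewrite ler_pdivrMr // mulrC -ler_pdivrMr //.
  apply: le_trans nk; apply: (@le_trans _ _ (`|C| / t)); last by rewrite lerDl.
  by rewrite ler_pM2r ?invr_gt0 // ler_norm.
by move: u1; clear; lra.
Qed.
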